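(* Let $(M,g)$ be a connected smooth Riemannian manifold, let $X$ be a smooth vector field on $M$, and let $p_0,q_0\in M$. Let $p(t)=\mathrm{Fl}^X_t(p_0)$ and $q(t)=\mathrm{Fl}^X_t(q_0)$, and suppose that there exists some relatively compact submanifold $N$ of $M$ containing $p_0,q_0$ such that $d(p_0,q_0)=d_N(p_0,q_0)$. Fix $T>0$ such that $\mathrm{Fl}^X$ is defined on $[0,T]\times N$ and set $C_T:=\sup\{\|\nabla X(p)\|_g : p\in\mathrm{Fl}^X([0,T]\times N)\}$. Then $$d(p(t),q(t))\le d(p_0,q_0)\,e^{C_T t}\qquad (t\in[0,T]).$$
   Context: $d$ denotes the Riemannian distance on $(M,g)$, and $d_N$ the Riemannian distance on $N$ with respect to the metric induced by $g$, i.e. the infimum of the $g$-lengths of piecewise smooth curves lying in $N$ and connecting the two points. Relatively compact means having compact closure in $M$. $\nabla$ denotes the Levi-Civita connection of $(M,g)$, and $\nabla X$ is the covariant differential of $X$. $\|\nabla X(p)\|_g$ is the operator norm of the linear map $\nabla X(p):(T_pM,\|\cdot\|_g)\to(T_pM,\|\cdot\|_g)$, $Y_p\mapsto\nabla_{Y_p}X$. The supremum defining $C_T$ is taken in $[0,\infty]$. $\mathrm{Fl}^X$ denotes the (maximal local) flow of $X$, i.e. $t\mapsto\mathrm{Fl}^X_t(p)$ is the maximal integral curve of $X$ with value $p$ at $t=0$; saying that $\mathrm{Fl}^X$ is defined on $[0,T]\times A$ means that $\mathrm{Fl}^X_t(p)$ exists for all $t\in[0,T]$ and $p\in A$, and $\mathrm{Fl}^X([0,T]\times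 A)=\{\mathrm{Fl}^X_t(p): t\in[0,T],\,p\in A\}$. Neither $(M,g)$ nor $X$ is assumed to be complete. *)

(* Defs.v *)
From HB Require Import structures.
From mathcomp Require Import all_boot all_order all_algebra.
From mathcomp Require Import all_classical all_reals all_analysis.
From mathcomp Require Import ring.

Set Implicit Arguments.
Unset Strict Implicit.
Unset Printing Implicit Defensive.

Import Order.TTheory GRing.Theory Num.Theory.
Import numFieldNormedType.Exports.

Local Open Scope classical_set_scope.
Local Open Scope ring_scope.

(* Only meaningful when [U] is open.  Iterated directional derivatives in all
   directions exist and are continuous, which in finite dimension is the usual
   C^k condition on partial derivatives. *)
Fixpoint Ck_on (R : realType) (V W : normedModType R) (k : nat) (U : set V)
    (f : V -> W) : Prop :=
  (forall x, U x -> {for x, continuous f}) /\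
  match k with
  | 0%N => True
  | k'.+1 => forall v : V,
      (forall x, U x -> derivable f x v) /\ Ck_on k' U (fun x => 'D_v f x)
  end.

Definition smooth_on (R : realType) (V W : normedModType R) (U : set V)
    (f : V -> W) : Prop :=
  forall k, Ck_on k U f.

(* [cmap] and [cinv] are total functions; their values off [cdom] and off its
   image carry no information. *)
Record chart (R : realType) (M : topologicalType) (n : nat) := Chart {
  cdom : set M ;
  cmap : M -> 'rV[R]_n ;
  cinv : 'rV[R]_n -> M ;
  open_cdom : open cdom ;
  open_cimg : open (cmap @` cdom) ;
  cmapK : forall p, cdom p -> cinv (cmap p) = p ;
  cmap_continuous : forall p, cdom p -> {for p, continuous cmap} ;
  cinv_continuous : forall x, (cmap @` cdom) x -> {for x, continuous cinv} }.

Definition cimg (R : realType) (M : topologicalType) (n : nat)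
    (c : chart R M n) : set 'rV[R]_n := cmap c @` cdom c.

Definition transition (R : realType) (M : topologicalType) (n : nat)
    (c c' : chart R M n) : 'rV[R]_n -> 'rV[R]_n := cmap c' \o cinv c.

(* [chart_at] records that the atlas covers.  It is also the chart in which
   chart-independent quantities at a point are evaluated. *)
Record manifold (R : realType) (n : nat) := Manifold {
  carrier :> topologicalType ;
  manifold_hausdorff : hausdorff_space carrier ;
  manifold_second_countable : @second_countable carrier ;
  atlas : set (chart R carrier n) ;
  chart_at : carrier -> chart R carrier n ;
  chart_at_atlas : forall p, atlas (chart_at p) ;
  mem_chart_at : forall p, cdom (chart_at p) p ;
  transition_smooth : forall c c', atlas c -> atlas c' ->
    smooth_on (cmap c @` (cdom c `&` cdom c')) (transition c c') }.

Definition smooth_map (R : realType) (k n : nat) (N : manifold R k)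
    (M : manifold R n) (f : N -> M) : Prop :=
  continuous f /\
  forall c c', atlas c -> atlas c' ->
    smooth_on (cmap c @` (cdom c `&` f @^-1` cdom c')) (cmap c' \o f \o cinv c).

(* [N] together with [iota] is an (immersed) submanifold, identified with the
   subset [range iota]; embedded submanifolds are the special case in which
   [iota] is moreover a homeomorphism onto its image. *)
Definition submanifold (R : realType) (k n : nat) (N : manifold R k)
    (M : manifold R n) (iota : N -> M) : Prop :=
  [/\ injective iota, smooth_map iota &
      forall (x : N) c c', atlas c -> atlas c' -> cdom c x ->
        cdom c' (iota x) -> forall v : 'rV[R]_k,
        'D_v (cmap c' \o iota \o cinv c) (cmap c x) = 0 -> v = 0].

Definition relatively_compact (T : topologicalType) (A : set T) : Prop :=
  compact (closure A).

Definition bilin (R : realType) (n : nat) (G : 'M[R]_n) (v w : 'rV[R]_n) : R :=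
  (v *m G *m w^T) 0 0.

(* ['D_v (transition c c') x] is the Jacobian of the change of charts at [x],
   applied to [v]. *)
Record vector_field (R : realType) (n : nat) (M : manifold R n) := VectorField {
  vf_loc :> chart R M n -> 'rV[R]_n -> 'rV[R]_n ;
  vf_smooth : forall c, atlas c -> smooth_on (cimg c) (vf_loc c) ;
  vf_compat : forall c c' p, atlas c -> atlas c' -> cdom c p -> cdom c' p ->
    vf_loc c' (cmap c' p) =
    'D_(vf_loc c (cmap c p)) (transition c c') (cmap c p) }.

Record riem_metric (R : realType) (n : nat) (M : manifold R n) := RiemMetric {
  metric_loc :> chart R M n -> 'rV[R]_n -> 'M[R]_n ;
  metric_smooth : forall c, atlas c -> smooth_on (cimg c) (metric_loc c) ;
  metric_sym : forall c x, atlas c -> cimg c x ->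
    (metric_loc c x)^T = metric_loc c x ;
  metric_posdef : forall c x, atlas c -> cimg c x ->
    forall v : 'rV[R]_n, v != 0 -> 0 < bilin (metric_loc c x) v v ;
  metric_compat : forall c c' p, atlas c -> atlas c' -> cdom c p -> cdom c' p ->
    forall v w : 'rV[R]_n,
    bilin (metric_loc c' (cmap c' p))
      ('D_v (transition c c') (cmap c p)) ('D_w (transition c c') (cmap c p)) =
    bilin (metric_loc c (cmap c p)) v w }.

Definition gnorm (R : realType) (n : nat) (G : 'M[R]_n) (v : 'rV[R]_n) : R :=
  Num.sqrt (bilin G v v).

Definition smooth_curve_on (R : realType) (n : nat) (M : manifold R n)
    (J : set R) (gamma : R -> M) : Prop :=
  (forall t, J t -> {for t, continuous gamma}) /\
  forall c, atlas c ->
    smooth_on (J `&` gamma @^-1` cdom c) (cmap c \o gamma).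

(* Smooth on the closed interval [u, v]: restriction of a smooth curve defined
   on a larger open interval. *)
Definition smooth_arc (R : realType) (n : nat) (M : manifold R n)
    (u v : R) (gamma : R -> M) : Prop :=
  exists (e : R) (delta : R -> M),
    [/\ 0 < e, smooth_curve_on `]u - e, v + e[ delta &
        forall t, u <= t <= v -> gamma t = delta t].

Definition piecewise_smooth (R : realType) (n : nat) (M : manifold R n)
    (a b : R) (gamma : R -> M) : Prop :=
  exists2 s : seq R, itv_partition a b s &
    forall i, (i < size s)%N ->
      smooth_arc (nth b (a :: s) i) (nth b s i) gamma.

Definition speed (R : realType) (n : nat) (M : manifold R n)
    (g : riem_metric M) (gamma : R -> M) (t : R) : R :=
  let c := chart_at (gamma t) in
  gnorm (g c (cmap c (gamma t))) ('D_1 (cmap c \o gamma) t).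

(* At the finitely many break points [speed] has an arbitrary value, which does
   not affect the integral. *)
Definition curve_length (R : realType) (n : nat) (M : manifold R n)
    (g : riem_metric M) (a b : R) (gamma : R -> M) : \bar R :=
  (\int[lebesgue_measure]_(t in `[a, b]) (speed g gamma t)%:E)%E.

Definition riem_dist (R : realType) (n : nat) (M : manifold R n)
    (g : riem_metric M) (p q : M) : \bar R :=
  ereal_inf [set L | exists (a b : R) (gamma : R -> M),
    [/\ a <= b, piecewise_smooth a b gamma, gamma a = p, gamma b = q &
        L = curve_length g a b gamma]].

(* Distance on the submanifold [iota : N -> M] for the metric induced by [g]:
   the curves run in [N], their length is measured by [g] in [M]. *)
Definition induced_dist (R : realType) (k n : nat) (N : manifold R k)
    (M : manifold R n) (g : riem_metric M) (iota : N -> M) (x y : N) : \bar R :=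
  ereal_inf [set L | exists (a b : R) (gamma : R -> N),
    [/\ a <= b, piecewise_smooth a b gamma, gamma a = x, gamma b = y &
        L = curve_length g a b (iota \o gamma)]].

Definition partial (R : realType) (n : nat) (i : 'I_n) (f : 'rV[R]_n -> R)
    (x : 'rV[R]_n) : R := 'D_(delta_mx 0 i) f x.

(* [christoffel g c x k i j] is Gamma^k_{ij} at the point with coordinates [x];
   lemmas [christoffel_torsion_free], [christoffel_metric] and
   [christoffel_unique] below show that these are the coefficients of the unique
   torsion-free metric connection. *)
Definition christoffel (R : realType) (n : nat) (M : manifold R n)
    (g : riem_metric M) (c : chart R M n) (x : 'rV[R]_n) (k i j : 'I_n) : R :=
  2^-1 * \sum_(l < n) invmx (g c x) k l *
    (partial i (fun y => g c y j l) x + partial j (fun y => g c y i l) x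
     - partial l (fun y => g c y i j) x).

Lemma metric_entryC (R : realType) (n : nat) (M : manifold R n)
    (g : riem_metric M) c x : atlas c -> cimg c x ->
  forall i j, g c x i j = g c x j i.
Proof. by move=> ac cx i j; rewrite -[in RHS](metric_sym g ac cx) mxE. Qed.

Lemma metric_unit (R : realType) (n : nat) (M : manifold R n)
    (g : riem_metric M) c x : atlas c -> cimg c x -> g c x \in unitmx.
Proof.
move=> ac cx; rewrite unitmxE unitfE; apply/det0P => -[v v0 vg].
by have := metric_posdef g ac cx v0; rewrite /bilin vg mul0mx mxE ltxx.
Qed.

Lemma partial_metricC (R : realType) (n : nat) (M : manifold R n)
    (g : riem_metric M) c x : atlas c -> cimg c x -> forall l i j,
  partial l (fun y => g c y i j) x = partial l (fun y => g c y j i) x.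
Proof.
move=> ac cx l i j; apply: near_eq_derive.
have ncx : nbhs x (cimg c) by apply: open_nbhs_nbhs; split=> //; exact: open_cimg.
by apply: filterS ncx => y cy; exact: metric_entryC.
Qed.

Lemma christoffel_torsion_free (R : realType) (n : nat) (M : manifold R n)
    (g : riem_metric M) c x : atlas c -> cimg c x -> forall k i j,
  christoffel g c x k i j = christoffel g c x k j i.
Proof.
move=> ac cx k i j; rewrite /christoffel; congr (_ * _).
apply: eq_bigr => l _; congr (_ * _).
by rewrite (partial_metricC g ac cx l i j); ring.
Qed.

Lemma christoffel_lower (R : realType) (n : nat) (M : manifold R n)
    (g : riem_metric M) c x : atlas c -> cimg c x -> forall m i j,
  \sum_(k < n) christoffel g c x k i j * g c x k m =
  2^-1 * (partial i (fun y => g c y j m) x + partial j (fun y => g c y i m) x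
          - partial m (fun y => g c y i j) x).
Proof.
move=> ac cx m i j; rewrite /christoffel.
under eq_bigr => k _ do rewrite -mulrA big_distrl.
rewrite -big_distrr /=; congr (_ * _); rewrite exchange_big /=.
have gV l : \sum_(k < n) invmx (g c x) k l * g c x k m = (m == l)%:R.
  have /matrixP/(_ m l) := mulmxV (metric_unit g ac cx).
  rewrite !mxE => <-; apply: eq_bigr => k _.
  by rewrite mulrC (metric_entryC g ac cx k m).
under eq_bigr => l _.
  under eq_bigr => k _ do rewrite /= mulrAC.
  rewrite -big_distrl /= gV.
  over.
rewrite (bigD1 m) //= big1 => [|l /negPf lm]; first by rewrite eqxx mul1r addr0.
by rewrite eq_sym lm mul0r.
Qed.

Lemma christoffel_metric (R : realType) (n : nat) (M : manifold R n)
    (g : riem_metric M) c x : atlas c -> cimg c x -> forall k i j,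
  partial k (fun y => g c y i j) x =
  \sum_(l < n) (christoffel g c x l k i * g c x l j +
                christoffel g c x l k j * g c x l i).
Proof.
move=> ac cx k i j; rewrite big_split /= !(christoffel_lower g ac cx).
by rewrite (partial_metricC g ac cx k j i); field.
Qed.

Lemma christoffel_unique (R : realType) (n : nat) (M : manifold R n)
    (g : riem_metric M) c x (Gamma : 'I_n -> 'I_n -> 'I_n -> R) :
  atlas c -> cimg c x ->
  (forall k i j, Gamma k i j = Gamma k j i) ->
  (forall k i j, partial k (fun y => g c y i j) x =
     \sum_(l < n) (Gamma l k i * g c x l j + Gamma l k j * g c x l i)) ->
  forall k i j, Gamma k i j = christoffel g c x k i j.
Proof.
move=> ac cx symG metG k i j.
pose low m a b := \sum_(l < n) Gamma l a b * g c x l m.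
have lowE m a b : low m a b = \sum_(l < n) christoffel g c x l a b * g c x l m.
  have E p q r : partial p (fun y => g c y q r) x = low r p q + low q p r.
    by rewrite metG big_split.
  have S p q r : low p q r = low p r q.
    by apply: eq_bigr => l _; rewrite symG.
  rewrite (christoffel_lower g ac cx) !E (S a b m) (S m b a) (S b a m).
  by rewrite (S a m b) (S b m a); field.
pose u := \row_l (Gamma l i j - christoffel g c x l i j).
suff u0 : u = 0 by apply/eqP; rewrite -subr_eq0; have /rowP/(_ k) := u0; rewrite !mxE => ->.
have ug : u *m g c x = 0.
  apply/rowP => m; rewrite !mxE.
  under eq_bigr => l _ do rewrite mxE mulrBl.
  by rewrite big_split /= sumrN -lowE subrr.
by rewrite -[u](mulmxK (metric_unit g ac cx)) ug mul0mx.
Qed.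

(* Components, in the chart [c] at the point with coordinates [x], of the
   covariant derivative of [X] in the direction [v]. *)
Definition cov_deriv (R : realType) (n : nat) (M : manifold R n)
    (g : riem_metric M) (X : vector_field M) (c : chart R M n)
    (x v : 'rV[R]_n) : 'rV[R]_n :=
  \row_k (('D_v (X c) x) 0 k +
          \sum_(i < n) \sum_(j < n) christoffel g c x k i j * v 0 i * X c x 0 j).

(* Operator norm of v |-> nabla_v X on the tangent space at [p]. *)
Definition nabla_norm (R : realType) (n : nat) (M : manifold R n)
    (g : riem_metric M) (X : vector_field M) (p : M) : \bar R :=
  let c := chart_at p in
  let x := cmap c p in
  ereal_sup [set (gnorm (g c x) (cov_deriv g X c x v))%:E |
             v in [set v | gnorm (g c x) v <= 1]].

Definition integral_curve (R : realType) (n : nat) (M : manifold R n)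
    (X : vector_field M) (J : set R) (gamma : R -> M) : Prop :=
  forall t, J t -> {for t, continuous gamma} /\
    forall c, atlas c -> cdom c (gamma t) ->
      is_derive t 1 (cmap c \o gamma) (X c (cmap c (gamma t))).

Definition integral_curve_at (R : realType) (n : nat) (M : manifold R n)
    (X : vector_field M) (p : M) (J : set R) (gamma : R -> M) : Prop :=
  [/\ open J, is_interval J, J 0, gamma 0 = p & integral_curve X J gamma].

(* Maximal: not extendable to a larger open interval. *)
Definition maximal_integral_curve (R : realType) (n : nat) (M : manifold R n)
    (X : vector_field M) (p : M) (J : set R) (gamma : R -> M) : Prop :=
  integral_curve_at X p J gamma /\
  forall (J' : set R) (delta : R -> M), integral_curve_at X p J' delta ->
    J `<=` J' -> (forall t, J t -> delta t = gamma t) -> J' = J.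

(* [Fl t p] is the flow at time [t] of [p], defined for [t] in [D p]; its values
   for other [t] carry no information. *)
Definition is_flow (R : realType) (n : nat) (M : manifold R n)
    (X : vector_field M) (D : M -> set R) (Fl : R -> M -> M) : Prop :=
  forall p, maximal_integral_curve X p (D p) (Fl ^~ p).

Definition flow_image (R : realType) (n : nat) (M : manifold R n)
    (Fl : R -> M -> M) (T : R) (A : set M) : set M :=
  [set q | exists t p, [/\ 0 <= t <= T, A p & q = Fl t p]].

Definition sup_nabla_norm (R : realType) (n : nat) (M : manifold R n)
    (g : riem_metric M) (X : vector_field M) (A : set M) : \bar R :=
  ereal_sup (nabla_norm g X @` A).

(* Main.v *)
Require Import Defs.
From HB Require Import structures.
From mathcomp Require Import all_boot all_order all_algebra.
From mathcomp Require Import all_classical all_reals all_analysis.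
From mathcomp Require Import measurable_realfun ring lra.
(* [gnorm] is also the name of a lemma of mathcomp. *)
Import Defs.

(** Join the two points by a curve [gamma] in [N] of almost minimal length and
    flow it.  The infinitesimal estimate is that the displacement [w] between
    two nearby integral curves satisfies, in a chart and up to an arbitrarily
    small error in the rate, [(1/2) d/dt g(w, w) = (1/2) (L_X g)(w, w) =
    g(nabla_w X, w) <= C_T g(w, w)], so that [|w|_g] grows at most like
    [exp (C_T t)].

    Smoothness of the flow in the initial point is never used.  The flowed curve
    [s |-> Fl t (gamma s)] is only shown to have upper speed at most
    [exp ((C_T + e) t) |gamma' s|] at every [s] (the predicate [displacement]),
    by Gronwall's inequality in a chart and a continuous induction on [t]; a
    second continuous induction, on [s], then replaces it by a polygon of
    coordinate segments of almost the same length.  When [C_T = +oo] the bound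
    is void unless [d(p0, q0) = 0], and then [p0 = q0]. *)

Set Implicit Arguments.
Unset Strict Implicit.
Unset Printing Implicit Defensive.

Import Order.TTheory GRing.Theory Num.Theory.
Import numFieldNormedType.Exports.

Local Open Scope classical_set_scope.
Local Open Scope ring_scope.

(** * Continuous induction and calculus in coordinates *)

(** The constant [C_T] controls [nabla X] only on the flow image, whereas the chord between two
    nearby integral curves may leave that set. The growth rate is therefore known at one base point
    only and is spread to a small ball by continuity, at the price of the [e] in [C_T + e]; this [e]
    is sent to 0 after the distance has been bounded. The flowed curve is not known to be
    differentiable, so its [speed] and [curve_length] carry no information. The speed bound is
    instead a statement about difference quotients at a single [s]: the neighbourhood of [s] on
    which it holds may shrink with [t], and no uniformity in [s] is needed, because the induction on
    [s] consumes it point by point. That induction is stated for an abstract cost predicate [Q] and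
    is used twice: with [Q] the reachability of the flowed point, and with [Q] a bound on a
    truncated coordinate distance, which shows that points at induced distance 0 coincide. *)

Lemma real_induction (R : realType) (a b : R) (P : R -> Prop) :
  a <= b -> P a ->
  (forall x, a <= x < b -> (forall y, a <= y <= x -> P y) ->
    \forall y \near x, x < y -> P y) ->
  (forall x, a < x <= b -> (forall y, a <= y < x -> P y) -> P x) ->
  forall x, a <= x <= b -> P x.
Proof.
move=> ab Pa Pright Pleft.
(* Membership in [S] records the whole past of [x], so that both steps can be applied at the
   supremum. *)
pose S := [set x | a <= x <= b /\ forall y, a <= y <= x -> P y].
have Sa : S a by split; [lra|move=> y ?; have -> : y = a by lra].
have ubS : ubound S b by move=> x [] /andP[].
have hS : has_sup S by split; [exists a | exists b].
pose s := sup S.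
have sa : a <= s by apply: ub_le_sup => //; exists b.
have sb : s <= b by apply: ge_sup => //; exists a.
have Plt y : a <= y < s -> P y.
  move=> /andP[ay ys]; have [z [_ Sz] yz] := sup_gt (ex_intro _ a Sa) ys.
  by apply: Sz; rewrite ay ltW.
have Ps : P s.
  have [-> //|sna] := eqVneq s a.
  by apply: Pleft => //; rewrite sb lt_neqAle eq_sym sna sa.
have Ple y : a <= y <= s -> P y.
  move=> /andP[ay]; rewrite le_eqVlt => /orP[/eqP -> //|ys].
  by apply: Plt; rewrite ay.
suff -> : b = s by [].
apply/eqP; rewrite eq_le sb andbT leNgt; apply/negP => sltb.
have /nbhs_ballP[e /= e0 He] : \forall y \near s, s < y -> P y.
  by apply: Pright => //; rewrite sa.
pose z := s + Num.min (e / 2) (b - s).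
have m0 : 0 < Num.min (e / 2) (b - s) by rewrite lt_min; apply/andP; split; lra.
have me : Num.min (e / 2) (b - s) <= e / 2 by rewrite ge_min lexx.
have mb : Num.min (e / 2) (b - s) <= b - s by rewrite ge_min lexx orbT.
have Sz : S z.
  split; first by rewrite /z; lra.
  move=> y /andP[ay yz]; have [ys|sy] := leP y s; first by apply: Ple;
      rewrite ay.
  apply: He => //=; rewrite /ball/= ltr_norml; rewrite /z in yz; lra.
have : z <= s by apply: ub_le_sup => //; exists b.
rewrite /z; lra.
Qed.

Lemma is_derive_near (R : realType) (W : normedModType R) (f : R -> W)
    (t : R) (d : W) (e : R) : is_derive t 1 f d -> 0 < e ->
  \forall y \near t, `|f y - f t - (y - t) *: d| <= e * `|y - t|.
Proof.
move=> df e0; have dt := @ex_derive _ _ _ _ _ _ _ df.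
have : (fun h => h^-1 *: ((f \o shift t) (h *: 1) - f t)) @ 0^' --> d.
  by rewrite -(@derive_val _ _ _ _ _ _ _ df).
move=> /cvgrPdist_le/(_ _ e0)/nbhs_ballP[r /= r0 Hr].
apply/nbhs_ballP; exists r => //= y ty.
have [->|ynt] := eqVneq y t;
    first by rewrite !subrr scale0r subr0 !normr0 mulr0.
have yt0 : y - t != 0 by rewrite subr_eq0.
have yt : ball 0 r (y - t) by rewrite /ball/= sub0r normrN distrC.
have := Hr _ yt yt0.
rewrite /= -[(y - t) *: 1]/((y - t) * 1) mulr1 subrK => H.
rewrite [leLHS]distrC -[f y - f t](scalerKV yt0) -scalerBr normrZ mulrC.
by rewrite ler_pM2r ?normr_gt0.
Qed.

(** The values lie in a normed space, where Rolle's argument fails. The bound is propagated by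
    continuous induction instead, with slack [d] in the slope to absorb the first-order error at
    each point. *)
Lemma mean_value_inequality (R : realType) (W : normedModType R)
    (f f' : R -> W) (a b K : R) :
  a <= b -> (forall t, a <= t <= b -> is_derive t 1 f (f' t)) ->
  (forall t, a <= t <= b -> `|f' t| <= K) ->
  `|f b - f a| <= K * (b - a).
Proof.
move=> ab df f'K; apply/ler_addgt0Pr => e e0.
have [->|aneb] := eqVneq a b; first by rewrite !subrr normr0 mulr0 add0r ltW.
have ba0 : 0 < b - a by rewrite subr_gt0 lt_neqAle aneb.
pose d := e / (b - a); have d0 : 0 < d by rewrite divr_gt0.
have -> : K * (b - a) + e = (K + d) * (b - a).
  by rewrite mulrDl /d divfK ?gt_eqF.
have nearD t : a <= t <= b ->
    \forall y \near t, `|f y - f t| <= (K + d) * `|y - t|.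
  move=> tab; have dft := df _ tab.
  near=> y.
  have H : `|f y - f t - (y - t) *: f' t| <= d * `|y - t|.
    by near: y; exact: is_derive_near.
  rewrite -(subrK ((y - t) *: f' t) (f y - f t)) (le_trans (ler_normD _ _))//.
  rewrite mulrDl addrC lerD// normrZ mulrC ler_wpM2r//; exact: f'K.
apply: (@real_induction R a b (fun x => `|f x - f a| <= (K + d) * (x - a)) ab)
    => //; last 1 first.
- by rewrite ab lexx.
- by rewrite !subrr normr0 mulr0.
- move=> x /andP[ax xb] /(_ x); rewrite ax lexx => /(_ isT) IH.
  near=> y => xy.
  have H : `|f y - f x| <= (K + d) * `|y - x|.
    by near: y; apply: nearD; rewrite ax ltW.
  rewrite gtr0_norm ?subr_gt0// in H.
  rewrite -(subrKA (f x)) (le_trans (ler_normD _ _))// (le_trans (lerD H IH))//.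
  by rewrite -mulrDr addrA subrK.
- move=> x /andP[ax xb] IH.
  have H : \forall y \near x, `|f y - f x| <= (K + d) * `|y - x|.
    by apply: nearD; rewrite xb ltW.
  have [y [yx ay H']] : exists y, [/\ y < x, a <= y & `|f y - f x| <= (K + d) *
      `|y - x|].
    near x^'- => y; exists y; split; near: y.
    - exact: nbhs_left_lt.
    - exact: nbhs_left_ge.
    - by rewrite near_withinE; apply: filterS H.
  rewrite distrC ltr0_norm ?subr_lt0// in H'.
  rewrite -(subrKA (f y)) (le_trans (ler_normD _ _))//.
  have := IH y; rewrite ay yx => /(_ isT) IHy.
  rewrite (le_trans (lerD H' IHy))//.
  by rewrite -mulrDr opprB addrA subrK.
Unshelve. all: by end_near. Qed.

Lemma ball_segment (R : realType) (V : normedModType R) (x0 x y : V) (r s : R) :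
  ball x0 r x -> ball x0 r y -> 0 <= s <= 1 -> ball x0 r (x + s *: (y - x)).
Proof.
rewrite -!ball_normE /ball_/= => xr yr /andP[s0 s1].
have -> : x0 - (x + s *: (y - x)) = (1 - s) *: (x0 - x) + s *: (x0 - y).
  have -> : y - x = (x0 - x) - (x0 - y) by rewrite [in RHS]opprB [RHS]addrC
      subrKA.
  by rewrite opprD addrA scalerBr opprB scalerBl scale1r addrCA addrC.
rewrite (le_lt_trans (ler_normD _ _))// !normrZ !ger0_norm ?subr_ge0//.
have [->|s0'] := eqVneq s 0; first by rewrite subr0 mul1r mul0r addr0.
have sp : 0 < s by rewrite lt_neqAle eq_sym s0' s0.
rewrite (@lt_le_trans _ _ ((1 - s) * r + s * r))//;
    last by rewrite -mulrDl subrK mul1r.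
by rewrite ler_ltD// ?ltr_pM2l// ler_wpM2l ?subr_ge0// ltW.
Qed.

(** The two difference quotients coincide as functions of [h], so derivability and derivative along
    a line transfer without any regularity of [f]. *)
Lemma growth_rate_line (R : realType) (V W : normedModType R) (f : V -> W)
    (x w : V) (t v : R) :
  (fun h : R => h^-1 *: (((fun s : R => f (x + s *: w)) \o shift t) (h *: v)
    - f (x + t *: w))) =
  (fun h : R => h^-1 *: ((f \o shift (x + t *: w)) (h *: (v *: w))
    - f (x + t *: w))).
Proof.
apply/funext => h /=; congr (_ *: (f _ - _)).
by rewrite scalerDl addrCA scalerA.
Qed.

Lemma derivable_line (R : realType) (V W : normedModType R) (f : V -> W)
    (x w : V) (t v : R) :
  derivable (fun s : R => f (x + s *: w)) t v <->
  derivable f (x + t *: w) (v *: w).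
Proof. by rewrite /derivable growth_rate_line. Qed.

Lemma derive_line (R : realType) (V W : normedModType R) (f : V -> W)
    (x w : V) (t v : R) :
  'D_v (fun s : R => f (x + s *: w)) t = 'D_(v *: w) f (x + t *: w).
Proof. by rewrite /derive growth_rate_line. Qed.

(** Mean value inequality for [f (x + t *: v) - t *: 'D_v f x0], whose derivative is small near [x0]
    because ['D_v f] is continuous there. *)
Lemma C1_strict_dir (R : realType) (V W : normedModType R) (U : set V)
    (f : V -> W) (x0 v : V) (e : R) :
  open U -> U x0 -> Ck_on 1 U f -> 0 < e ->
  exists2 r, 0 < r & ball x0 r `<=` U /\ forall x h,
    ball x0 r x -> ball x0 r (x + h *: v) ->
    `|f (x + h *: v) - f x - h *: 'D_v f x0| <= e * `|h|.
Proof.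
move=> oU Ux0 [_ /(_ v)[fd [/(_ _ Ux0) cD _]]] e0.
have nU : nbhs x0 U by apply: open_nbhs_nbhs.
have /nbhs_ballP[r /= r0 Hr] :
    \forall x \near x0, U x /\ `|'D_v f x - 'D_v f x0| <= e.
  near=> x; split; first by near: x.
  rewrite distrC; near: x; exact: (cvgrPdist_le _ _).1.
exists r => //; split=> [x /Hr[]//|].
have H x h : 0 <= h -> ball x0 r x -> ball x0 r (x + h *: v) ->
    `|f (x + h *: v) - f x - h *: 'D_v f x0| <= e * `|h|.
  move=> h0 xr xhr.
  have br t : 0 <= t <= h -> ball x0 r (x + t *: v).
    move=> /andP[t0 th].
    have [th0|h0'] := eqVneq h 0.
      have -> : t = 0 by lra.
      by rewrite scale0r addr0.
    have := @ball_segment _ _ _ _ _ _ (t / h) xr xhr.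
    rewrite (addrC x (h *: v)) addrK scalerA divfK//; apply.
    have hp : 0 < h by lra.
    by rewrite divr_ge0// ler_pdivrMr// mul1r.
  pose phi t := f (x + t *: v) - t *: 'D_v f x0.
  have := @mean_value_inequality _ W phi (fun t => 'D_v f (x + t *: v) - 'D_v f
      x0) 0 h e h0.
  rewrite /phi scale0r addr0 scale0r subr0 subr0 (ger0_norm h0) addrAC; apply.
  - move=> t th; apply: is_deriveB.
      split; last by rewrite derive_line scale1r.
      by apply/derivable_line; rewrite scale1r; apply: fd;
          apply: (Hr _ (br _ th)).1.
    have -> : (fun t0 : R => t0 *: 'D_v f x0) = (fun t0 : R => 0 + t0 *: 'D_v f
        x0).
      by apply/funext => z; rewrite add0r.
    split; last by rewrite (derive_line id) scale1r derive_id.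
    by apply/(derivable_line id); exact: derivable_id.
  - by move=> t th; apply: (Hr _ (br _ th)).2.
(* For negative [h] the two endpoints exchange roles. *)
move=> x h xr xhr; have [h0|h0] := leP 0 h; first exact: H.
have := H (x + h *: v) (- h); rewrite oppr_ge0 (ltW h0) scaleNr addrK normrN.
move=> /(_ isT xhr xr) ; rewrite scaleNr opprK -normrN opprD opprB.
by [].
Unshelve. all: by end_near. Qed.

Lemma mx_norm_entry (R : realType) m n (A : 'M[R]_(m, n)) i j :
  `|A i j| <= `|A|.
Proof.
rewrite [leRHS]/Num.Def.normr/= mx_normrE; exact: (le_bigmax _ _ (i, j)).
Qed.

Lemma mx_norm_le (R : realType) m n (A : 'M[R]_(m, n)) e :
  0 <= e -> (forall i j, `|A i j| <= e) -> `|A| <= e.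
Proof.
move=> e0 H; rewrite [leLHS]/Num.Def.normr/= mx_normrE (bigmax_le _ e0)// => -[i
    j] _; exact: H.
Qed.

(** The coordinates are changed one at a time. The norm is the sup norm, so the intermediate points
    stay in the ball and each coordinate costs at most [d * |y - x|]; dividing by [n.+1] rather than
    [n] covers [n = 0]. *)
Lemma C1_strict (R : realType) n (W : normedModType R) (U : set 'rV[R]_n)
    (f : 'rV[R]_n -> W) (x0 : 'rV[R]_n) (e : R) :
  open U -> U x0 -> Ck_on 1 U f -> 0 < e ->
  exists2 r, 0 < r & ball x0 r `<=` U /\ forall x y,
    ball x0 r x -> ball x0 r y ->
    `|f y - f x - \sum_i (y - x) 0 i *: 'D_(delta_mx 0 i) f x0| <= e * `|y - x|.
Proof.
move=> oU Ux0 fC e0.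
pose d := e / n.+1%:R; have d0 : 0 < d by rewrite divr_gt0.
have nU : nbhs x0 U by apply: open_nbhs_nbhs.
have H0 : \forall s \near 0^'+, ball x0 s `<=` U /\ forall (i : 'I_n) x h,
    ball x0 s x -> ball x0 s (x + h *: delta_mx 0 i) ->
    `|f (x + h *: delta_mx 0 i) - f x - h *: 'D_(delta_mx 0 i) f x0| <= d *
        `|h|.
  apply: filterI.
    have /nbhs_ballP[r r0 rU] := nU.
    near=> s; apply: subset_trans rU; apply: le_ball.
    by near: s; exact: nbhs_right_le.
  pose P (i : 'I_n) (s : R) := forall x h,
    ball x0 s x -> ball x0 s (x + h *: delta_mx 0 i) ->
    `|f (x + h *: delta_mx 0 i) - f x - h *: 'D_(delta_mx 0 i) f x0| <= d *
        `|h|.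
  suff HP : forall i, \forall s \near 0^'+, P i s by exact: (filter_forall _
      HP).
  move=> i.
  have [r r0 [_ Hr]] := C1_strict_dir (delta_mx 0 i) oU Ux0 fC d0.
  near=> s; move=> x h xs hs.
  have le : ball x0 s `<=` ball x0 r.
    by apply: le_ball; near: s; exact: nbhs_right_le.
  by apply: Hr; exact: le.
have [s [s0 [sU Hs]]] : exists s, 0 < s /\ (ball x0 s `<=` U /\ 
    forall (i : 'I_n) x h,
    ball x0 s x -> ball x0 s (x + h *: delta_mx 0 i) ->
    `|f (x + h *: delta_mx 0 i) - f x - h *: 'D_(delta_mx 0 i) f x0| <= d *
        `|h|).
  near (0 : R)^'+ => s; exists s; split; near: s;
      [exact: nbhs_right_gt|exact: H0].
exists s => //; split=> [|x y xs ys]; first exact: sU.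
(* Induction on [k], where [x] and [y] may differ only in their first [k] coordinates. *)
suff H k : (k <= n)%N -> forall y, ball x0 s y ->
    (forall i : 'I_n, (k <= i)%N -> y 0 i = x 0 i) ->
    `|f y - f x - \sum_i (y - x) 0 i *: 'D_(delta_mx 0 i) f x0|
      <= k%:R * d * `|y - x|.
  have yx (i : 'I_n) : (n <= i)%N -> y 0 i = x 0 i by rewrite leqNgt ltn_ord.
  apply: le_trans (H n (leqnn _) y ys yx) _.
  rewrite ler_wpM2r// /d mulrCA ger_pMr// ler_pdivrMr// mul1r ler_nat.
  exact: leqnSn.
elim: k => [_ {}y {}ys yx|k IH kn {}y {}ys yx].
  have -> : y = x by apply/rowP => i; apply: yx.
  rewrite !subrr sub0r normrN normr0 mulr0.
  by rewrite big1 ?normr0// => i _; rewrite mxE scale0r.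
pose i0 : 'I_n := Ordinal kn.
pose h := y 0 i0 - x 0 i0.
pose z := y - h *: delta_mx 0 i0.
have zE i : z 0 i = if i == i0 then x 0 i else y 0 i.
  rewrite !mxE eqxx /=; case: eqVneq => [->|_]; last by rewrite mulr0 subr0.
  by rewrite mulr1 /h subKr.
have zh : z + h *: delta_mx 0 i0 = y by rewrite subrK.
clearbody z.
have zs : ball x0 s z.
  move: xs ys => [_ xs] [_ ys]; split=> // i j; rewrite ord1 zE.
  by case: ifP => _; [exact: xs|exact: ys].
have zx : `|z - x| <= `|y - x|.
  apply: mx_norm_le => // i j; rewrite ord1 !mxE zE.
  case: ifP => _; first by rewrite subrr normr0.
  by have := mx_norm_entry (y - x) 0 j; rewrite !mxE.
have hy : `|h| <= `|y - x|.
  by have := mx_norm_entry (y - x) 0 i0; rewrite !mxE.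
have zk : forall i : 'I_n, (k <= i)%N -> z 0 i = x 0 i.
  move=> i; rewrite zE; case: eqVneq => // ii0;
      rewrite leq_eqVlt => /orP[/eqP ki|].
    by case/eqP: ii0; apply/val_inj.
  exact: yx.
have {IH} := IH (ltnW kn) z zs zk.
have := Hs i0 z h zs; rewrite zh => /(_ ys) H1 H2.
have -> : \sum_i (y - x) 0 i *: 'D_(delta_mx 0 i) f x0 =
   h *: 'D_(delta_mx 0 i0) f x0 + \sum_i (z - x) 0 i *: 'D_(delta_mx 0 i) f x0.
  rewrite (bigD1 i0)//= [in RHS](bigD1 i0)//= !mxE zE eqxx subrr.
  rewrite scale0r add0r; congr (_ + _); apply: eq_bigr => i /negPf ii0.
  by rewrite [in RHS]mxE [in RHS]mxE zE ii0 [in LHS]mxE [in LHS]mxE.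
rewrite -[f y - f x](subrKA (f z)) opprD addrACA (le_trans (ler_normD _ _))//.
rewrite -natr1 mulrDl mulrDl mul1r [leRHS]addrC lerD//; last first.
  by rewrite (le_trans H2)// ler_wpM2l// mulr_ge0// ltW.
by rewrite (le_trans H1)// ler_wpM2l// ltW.
Unshelve. all: by end_near. Qed.

Lemma is_derive_of_near (R : realType) (W : normedModType R) (f : R -> W)
    (t : R) (d : W) :
  (forall e, 0 < e ->
    \forall y \near t, `|f y - f t - (y - t) *: d| <= e * `|y - t|) ->
  is_derive t 1 f d.
Proof.
move=> H.
have c : (fun h => h^-1 *: ((f \o shift t) (h *: 1) - f t)) @ 0^' --> d.
  apply/cvgrPdist_le => e e0.
  have /nbhs_ballP[r /= r0 Hr] := H e e0.
  apply/nbhs_ballP; exists r => //= h; rewrite /ball/= sub0r normrN => hr h0.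
  have := Hr (h + t); rewrite /ball/= opprD addrCA subrr addr0 normrN hr.
  move=> /(_ isT); rewrite addrK => Ht.
  rewrite -[h *: 1]/(h * 1) mulr1 distrC -[X in _ - X](scalerK h0) -scalerBr.
  by rewrite normrZ normfV ler_pdivrMl ?normr_gt0// mulrC.
by split; [apply/cvg_ex; exists d | exact: cvg_lim].
Qed.

Section C1.
Variables (R : realType) (n : nat) (W : normedModType R).
Variables (U : set 'rV[R]_n) (f : 'rV[R]_n -> W).
Hypotheses (oU : open U) (fC : Ck_on 1 U f).

(** [Ck_on] speaks of one direction at a time and does not assert linearity in the direction. [D] is
    the visibly linear candidate for the differential, and [derive_sum] identifies the two. *)
Let D x (v : 'rV[R]_n) := \sum_i v 0 i *: 'D_(delta_mx 0 i) f x.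

Let D_bound x : exists2 K, 0 < K & forall v, `|D x v| <= K * `|v|.
Proof.
exists (1 + \sum_i `|'D_(delta_mx 0 i) f x|).
  by rewrite ltr_pwDl// sumr_ge0.
move=> v; rewrite mulrDl mul1r ler_wpDl//.
rewrite (le_trans (ler_norm_sum _ _ _))// mulr_suml ler_sum// => i _.
by rewrite normrZ mulrC ler_wpM2l// mx_norm_entry.
Qed.

Let DZ x a v : D x (a *: v) = a *: D x v.
Proof. by rewrite /D scaler_sumr; apply: eq_bigr => i _; rewrite mxE scalerA.
    Qed.

Let DD x v w : D x (v + w) = D x v + D x w.
Proof.
by rewrite /D -big_split; apply: eq_bigr => i _ /=; rewrite mxE scalerDl.
Qed.

Let derive_sum x v : U x -> 'D_v f x = D x v.
Proof.
move=> Ux; apply: cvg_lim => //; apply/cvgrPdist_le => e e0.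
have d0 : 0 < e / (1 + `|v|) by rewrite divr_gt0// ltr_pwDl.
have [r r0 [_ Hr]] := C1_strict oU Ux fC d0.
near=> h.
have h0 : h != 0 by near: h; exact: nbhs_dnbhs_neq.
have := Hr x (h *: v + x) (ballxx _ r0).
have xh : ball x r (h *: v + x).
  rewrite -ball_normE /ball_/= opprD addrCA subrr addr0 normrN normrZ.
  rewrite (@le_lt_trans _ _ (`|h| * (1 + `|v|)))//.
    by rewrite ler_wpM2l// ler_wpDl.
  rewrite -ltr_pdivlMr ?ltr_pwDl//; near: h; apply: dnbhs0_lt.
  by rewrite divr_gt0// ltr_pwDl.
move=> /(_ xh); rewrite addrK => H.
rewrite distrC /= -[D x v](scalerK h0) -scalerBr normrZ normfV ler_pdivrMl
    ?normr_gt0//.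
rewrite -/(D _ _) DZ in H; rewrite (le_trans H)// normrZ mulrCA ler_wpM2l//.
by rewrite mulrAC ler_pdivrMr ?ltr_pwDl// ler_wpM2l ?(ltW e0)// ler_wpDl.
Unshelve. all: by end_near. Qed.

Lemma C1_derive_sum x v : U x ->
  'D_v f x = \sum_i v 0 i *: 'D_(delta_mx 0 i) f x.
Proof. exact: derive_sum. Qed.

Lemma C1_deriveZ x a v : U x -> 'D_(a *: v) f x = a *: 'D_v f x.
Proof. by move=> Ux; rewrite !derive_sum// DZ. Qed.

Lemma C1_deriveD x v w : U x -> 'D_(v + w) f x = 'D_v f x + 'D_w f x.
Proof. by move=> Ux; rewrite !derive_sum// DD. Qed.

Lemma C1_deriveB x v w : U x -> 'D_(v - w) f x = 'D_v f x - 'D_w f x.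
Proof. by move=> Ux; rewrite -scaleN1r C1_deriveD// C1_deriveZ// scaleN1r. Qed.

Lemma C1_derive_bound x : U x ->
  exists2 K, 0 < K & forall v, `|'D_v f x| <= K * `|v|.
Proof.
by move=> Ux; have [K K0 HK] := D_bound x; exists K => // v; rewrite derive_sum.
Qed.

Lemma C1_strictly_differentiable x0 e : U x0 -> 0 < e ->
  exists2 r, 0 < r & ball x0 r `<=` U /\ forall x y,
    ball x0 r x -> ball x0 r y ->
    `|f y - f x - 'D_(y - x) f x0| <= e * `|y - x|.
Proof.
move=> Ux0 e0; have [r r0 [rU H]] := C1_strict oU Ux0 fC e0.
by exists r => //; split=> // x y xr yr; rewrite derive_sum//; exact: H.
Qed.

Lemma C1_comp_is_derive (x : R -> 'rV[R]_n) (t : R) (d : 'rV[R]_n) :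
  U (x t) -> is_derive t 1 x d -> is_derive t 1 (f \o x) ('D_d f (x t)).
Proof.
move=> Uxt xd; apply: is_derive_of_near => e e0.
have [K K0 HK] := C1_derive_bound Uxt.
(* [e1] pays for the nonlinearity of [f], [e2] for the remainder of [x] pushed through the
   differential, whose norm is at most [K]; the cap 1 in [e2] gives the Lipschitz constant [|d| + 1]
   of [x] at [t]. *)
pose e1 := e / 2 / (`|d| + 1);
    have e10 : 0 < e1 by rewrite !divr_gt0// ltr_wpDl.
pose e2 := Num.min 1 (e / 2 / K).
have e20 : 0 < e2 by rewrite lt_min ltr01 !divr_gt0.
have [r r0 [rU H]] := C1_strictly_differentiable Uxt e10.
have cx : {for t, continuous x}.
  by apply: differentiable_continuous; apply/derivable1_diffP.
near=> s.
have Hs : `|x s - x t - (s - t) *: d| <= e2 * `|s - t|.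
  by near: s; exact: is_derive_near.
have Hs2 : ball (x t) r (x s).
  by near: s; apply: cx; exact: nbhsx_ballx.
have Hs3 : `|x s - x t| <= (`|d| + 1) * `|s - t|.
  rewrite -(subrK ((s - t) *: d) (x s - x t)) (le_trans (ler_normD _ _))//.
  rewrite mulrDl addrC lerD//; first by rewrite normrZ mulrC.
  by rewrite (le_trans Hs)// ler_wpM2r// ge_min lexx.
have H1 := H _ _ (ballxx _ r0) Hs2.
rewrite /= -C1_deriveZ// -[X in `|X|](subrKA ('D_(x s - x t) f (x t))).
rewrite (le_trans (ler_normD _ _))// [e]splitr mulrDl lerD//.
  rewrite (le_trans H1)// (le_trans (ler_wpM2l _ Hs3)) ?(ltW e10)//.
  by rewrite /e1 mulrA divfK// gt_eqF// ltr_wpDl.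
rewrite -C1_deriveB//.
rewrite (le_trans (HK _))// (le_trans (ler_wpM2l (ltW K0) Hs))// mulrA.
rewrite ler_wpM2r// mulrC -ler_pdivlMr//.
by rewrite ge_min lexx orbT.
Unshelve. all: by end_near. Qed.

Lemma C1_derive_continuous (T : topologicalType) (x v : T -> 'rV[R]_n) (t : T) :
  U (x t) -> {for t, continuous x} -> {for t, continuous v} ->
  {for t, continuous (fun s => 'D_(v s) f (x s))}.
Proof.
move=> Uxt cx cv.
have nU : \forall s \near t, U (x s) by apply: cx; apply: open_nbhs_nbhs.
have : {for t, continuous (fun s => D (x s) (v s))}.
  rewrite /prop_for /continuous_at /D.
  apply: (@cvg_big _ _ +%R 0) => [|i _]; first exact: add_continuous.
  apply: cvgZ.
    exact: (continuous_comp cv (@coord_continuous _ _ _ _ _ _)).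
  have [_ /(_ (delta_mx 0 i))[_ [H _]]] := fC.
  exact: (continuous_comp cx (H _ Uxt)).
rewrite /prop_for /continuous_at derive_sum// => H.
apply: cvg_trans H; apply: near_eq_cvg; near=> s.
by rewrite derive_sum//; near: s.
Unshelve. all: by end_near. Qed.

End C1.

(** * Inner products in coordinates *)

Section bilin.
Variables (R : realType) (n : nat).
Implicit Types (G H : 'M[R]_n) (u v w : 'rV[R]_n) (a : R).

Lemma bilinE G v w :
  bilin G v w = \sum_i \sum_j v 0 i * G i j * w 0 j.
Proof.
rewrite /bilin mxE exchange_big/=; apply: eq_bigr => j _.
by rewrite !mxE mulr_suml.
Qed.

Lemma bilinDl G u v w : bilin G (u + v) w = bilin G u w + bilin G v w.
Proof. by rewrite /bilin !mulmxDl mxE. Qed.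

Lemma bilinDr G u v w : bilin G w (u + v) = bilin G w u + bilin G w v.
Proof. by rewrite /bilin linearD mulmxDr mxE. Qed.

Lemma bilinZl G a v w : bilin G (a *: v) w = a * bilin G v w.
Proof. by rewrite /bilin -!scalemxAl mxE. Qed.

Lemma bilinZr G a v w : bilin G v (a *: w) = a * bilin G v w.
Proof. by rewrite /bilin linearZ -scalemxAr mxE. Qed.

Lemma bilinNl G v w : bilin G (- v) w = - bilin G v w.
Proof. by rewrite -scaleN1r bilinZl mulN1r. Qed.

Lemma bilinNr G v w : bilin G v (- w) = - bilin G v w.
Proof. by rewrite -scaleN1r bilinZr mulN1r. Qed.

Lemma bilinBG G H v w : bilin (G - H) v w = bilin G v w - bilin H v w.
Proof. by rewrite /bilin mulmxBr mulmxBl mxE; congr (_ + _); rewrite mxE. Qed.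

Lemma bilin0l G w : bilin G 0 w = 0.
Proof. by rewrite /bilin !mul0mx mxE. Qed.

Lemma bilinC G v w : G^T = G -> bilin G v w = bilin G w v.
Proof.
move=> sG; rewrite !bilinE exchange_big/=; apply: eq_bigr => i _.
apply: eq_bigr => j _; rewrite -{1}sG mxE; ring.
Qed.

Lemma bilin_le G v w : `|bilin G v w| <= (n * n)%:R * `|G| * `|v| * `|w|.
Proof.
rewrite bilinE (le_trans (ler_norm_sum _ _ _))//.
have -> : (n * n)%:R * `|G| * `|v| * `|w| = \sum_(i < n) \sum_(j < n) `|G| *
    `|v| * `|w|.
  by rewrite !sumr_const !card_ord -mulrnA -[RHS]mulr_natl !mulrA.
apply: ler_sum => i _; rewrite (le_trans (ler_norm_sum _ _ _))//.
apply: ler_sum => j _; rewrite !normrM [`|G| * _]mulrC.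
by rewrite !ler_pM ?mulr_ge0 ?mx_norm_entry.
Qed.

Definition posdef G := G^T = G /\ forall v, v != 0 -> 0 < bilin G v v.

Lemma gnorm_ge0 G v : 0 <= gnorm G v. Proof. exact: sqrtr_ge0. Qed.

Section posdef.
Variable G : 'M[R]_n.
Hypothesis pG : posdef G.

Lemma bilin_ge0 v : 0 <= bilin G v v.
Proof.
have [->|v0] := eqVneq v 0; first by rewrite bilin0l.
by apply/ltW; apply pG.2.
Qed.

Lemma gnorm_sqr v : gnorm G v ^+ 2 = bilin G v v.
Proof. by rewrite sqr_sqrtr// bilin_ge0. Qed.

Lemma gnorm_eq0 v : gnorm G v = 0 -> v = 0.
Proof.
move=> v0; apply/eqP; apply: contraT => /pG.2.
by rewrite -gnorm_sqr v0 expr0n ltxx.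
Qed.

Lemma gnorm0 : gnorm G 0 = 0.
Proof. by rewrite /gnorm bilin0l sqrtr0. Qed.

Lemma gnormZ a v : gnorm G (a *: v) = `|a| * gnorm G v.
Proof.
by rewrite /gnorm bilinZl bilinZr mulrA -expr2 sqrtrM ?sqr_ge0// sqrtr_sqr.
Qed.

Lemma gnormN v : gnorm G (- v) = gnorm G v.
Proof. by rewrite -scaleN1r gnormZ normrN1 mul1r. Qed.

Lemma bilin_cauchy v w : `|bilin G v w| <= gnorm G v * gnorm G w.
Proof.
have [->|w0] := eqVneq w 0.
  by rewrite gnorm0 mulr0 bilinC ?pG.1// bilin0l normr0.
set b := bilin G v w; set a := bilin G v v; set c := bilin G w w.
have c0 : 0 < c by exact: pG.2.
(* This is the quadratic form at [c *: v - b *: w], which avoids a division. *)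
have : 0 <= c * (a * c - b ^+ 2).
  have := bilin_ge0 (c *: v - b *: w).
  rewrite bilinDl !bilinDr !bilinNl !bilinNr !bilinZl !bilinZr -/a -/c -/b.
  rewrite (bilinC w v pG.1) -/b; congr (_ <= _); ring.
rewrite pmulr_rge0// subr_ge0 => H.
rewrite -(@ler_pXn2r _ 2) ?nnegrE ?mulr_ge0 ?gnorm_ge0//.
by rewrite exprMn !gnorm_sqr -normrX ger0_norm ?sqr_ge0.
Qed.

Lemma gnormD v w : gnorm G (v + w) <= gnorm G v + gnorm G w.
Proof.
rewrite -(@ler_pXn2r _ 2) ?nnegrE ?addr_ge0 ?gnorm_ge0//.
rewrite gnorm_sqr bilinDl !bilinDr (bilinC w v pG.1) sqrrD !gnorm_sqr.
have := le_trans (ler_norm _) (bilin_cauchy v w); lra.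
Qed.

(** The vector [u i] is dual to the [i]-th coordinate, that is [bilin G v (u i) = v 0 i], so
    Cauchy-Schwarz bounds every coordinate and no compactness of the unit sphere is involved. *)
Lemma gnorm_lower : exists2 K, 0 < K & forall v, `|v| <= K * gnorm G v.
Proof.
have uG : G \in unitmx.
  rewrite unitmxE unitfE; apply/det0P => -[v v0 vG].
  by have := pG.2 v v0; rewrite /bilin vG mul0mx mxE ltxx.
pose u i : 'rV[R]_n := (invmx G *m (delta_mx i 0 : 'cV_n))^T.
have uE v i : bilin G v (u i) = v 0 i.
  rewrite /bilin trmxK -mulmxA mulKVmx//.
  by rewrite -colE mxE.
exists (1 + \sum_i gnorm G (u i)).
  by rewrite ltr_pwDl// sumr_ge0// => i _; exact: gnorm_ge0.
move=> v; apply: mx_norm_le.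
  rewrite mulr_ge0 ?gnorm_ge0// addr_ge0// sumr_ge0// => i _; exact: gnorm_ge0.
move=> i j; rewrite ord1 -uE (le_trans (bilin_cauchy _ _))// mulrC.
rewrite ler_wpM2r ?gnorm_ge0// (bigD1 j)//= addrCA lerDl addr_ge0// sumr_ge0//.
by move=> k _; exact: gnorm_ge0.
Qed.

Lemma gnorm_upper : exists2 K, 0 < K & forall v, gnorm G v <= K * `|v|.
Proof.
exists (1 + (n * n)%:R * `|G|); first by rewrite ltr_pwDl// mulr_ge0.
move=> v; rewrite -(@ler_pXn2r _ 2) ?nnegrE ?mulr_ge0 ?gnorm_ge0 ?addr_ge0
    ?mulr_ge0//.
rewrite gnorm_sqr (le_trans (ler_norm _))// (le_trans (bilin_le _ _ _))//.
set k := _%:R * _; have k0 : 0 <= k by rewrite mulr_ge0.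
rewrite -mulrA -expr2 exprMn ler_wpM2r ?sqr_ge0//; nra.
Qed.

(* The tolerance [e / (1 + e)] makes [(1 - e / (1 + e)) (1 + e) = 1]. *)
Lemma gnorm_compare e : 0 < e -> exists2 d, 0 < d & forall H, `|H - G| <= d ->
  forall v, gnorm H v <= (1 + e) * gnorm G v /\
            gnorm G v <= (1 + e) * gnorm H v.
Proof.
move=> e0; have [K K0 HK] := gnorm_lower.
have N0 : 0 < (n * n)%:R * K ^+ 2 + 1 by rewrite ltr_wpDl// mulr_ge0// sqr_ge0.
pose th := e / (1 + e).
have th0 : 0 < th by rewrite divr_gt0// ltr_wpDl.
exists (th / ((n * n)%:R * K ^+ 2 + 1)); first by rewrite divr_gt0.
move=> H HG v.
have B0 := bilin_ge0 v.
have : `|bilin H v v - bilin G v v| <= th * bilin G v v.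
  rewrite -bilinBG (le_trans (bilin_le _ _ _))//.
  have vK : `|v| ^+ 2 <= K ^+ 2 * bilin G v v.
    rewrite -gnorm_sqr -exprMn lerXn2r ?nnegrE ?mulr_ge0 ?gnorm_ge0 ?(ltW K0)//.
  rewrite -mulrA -expr2.
  rewrite (@le_trans _ _ ((n * n)%:R * (th / ((n * n)%:R * K ^+ 2 + 1)) * (K ^+
      2 * bilin G v v)))//.
    by rewrite ler_pM ?mulr_ge0 ?sqr_ge0// ler_wpM2l.
  rewrite mulrA ler_wpM2r//.
  rewrite (_ : _ * _ * _ = th * (((n * n)%:R * K ^+ 2) / ((n * n)%:R * K ^+ 2 +
      1))); last by ring.
  by rewrite ger_pMr// ler_pdivrMr// mul1r lerDl.
have the : th * (1 + e) = e by rewrite /th divfK// gt_eqF// ltr_wpDl.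
rewrite ler_norml => /andP[H1 H2].
have le : th <= e by rewrite -[leRHS]the; nra.
have H3 : bilin G v v <= (1 + e) * bilin H v v.
  have -> : bilin G v v = (1 + e) * (bilin G v v - th * bilin G v v).
    have -> : th = e / (1 + e) by [].
    by field; rewrite gt_eqF// ltr_wpDl.
  by rewrite ler_wpM2l//; lra.
have H0 : 0 <= bilin H v v.
  by rewrite -(@pmulr_rge0 _ (1 + e)) ?ltr_wpDl// (le_trans B0 H3).
have e1 : 0 <= 1 + e by lra.
split; rewrite -(@ler_pXn2r _ 2) ?nnegrE ?mulr_ge0 ?gnorm_ge0// exprMn
    gnorm_sqr.
  rewrite /gnorm sqr_sqrtr//; nra.
rewrite /gnorm sqr_sqrtr//; nra.
Qed.

End posdef.
End bilin.

(** * Growth of a short chord under a vector field, in coordinates *)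

Section local_estimate.
Variables (R : realType) (n : nat) (U : set 'rV[R]_n).
Variables (X : 'rV[R]_n -> 'rV[R]_n) (G : 'rV[R]_n -> 'M[R]_n).
Hypotheses (oU : open U) (XC : Ck_on 1 U X) (GC : Ck_on 1 U G).

(* [lie x v w] is half of the Lie derivative (L_X g)(w, w) at [x] when
   [v] is the derivative of [X] in the direction [w]. *)
Let lie x v w := bilin (G x) v w + 2^-1 * bilin ('D_(X x) G x) w w.

(** The bound is assumed at [x0] only. Replacing [X y - X x] by ['D_w X x0] and freezing the metric
    and its derivative at [x0] costs at most [d * A * |w|^2], and [|w|^2] is at most [K2] times the
    squared length of [w]; [d] makes the product at most [e]. *)
Lemma lie_estimate (x0 : 'rV[R]_n) (C e : R) :
  U x0 -> posdef (G x0) ->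
  (forall w, lie x0 ('D_w X x0) w <= C * bilin (G x0) w w) -> 0 < e ->
  \forall r \near 0^'+, forall x y, ball x0 r x -> ball x0 r y ->
    lie x (X y - X x) (y - x) <= (C + e) * bilin (G x) (y - x) (y - x).
Proof.
move=> Ux0 pG hC e0.
have [K K0 HK] := gnorm_lower pG.
have [d1 d10 Hd1] := gnorm_compare pG ltr01.
have [K1 K10 HK1] := C1_derive_bound oU XC Ux0.
pose k : R := (n * n)%:R; have k0 : 0 <= k by [].
(* The four summands are the coefficients in [E1] to [E4]. The factor 2 in [K2] comes from comparing
   [G x] with [G x0] up to [1 + 1]. *)
pose A := k * (`|G x0| + 1) + k * K1 + k + `|C| * k.
have A0 : 0 <= A by rewrite !addr_ge0 ?mulr_ge0// ?addr_ge0// ltW.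
pose K2 := (2 * K) ^+ 2.
have K20 : 0 < K2 by rewrite exprn_gt0// mulr_gt0.
pose d := Num.min (Num.min 1 d1) (e / ((A + 1) * K2)).
have d0 : 0 < d by rewrite !lt_min ltr01 d10 divr_gt0// mulr_gt0// ltr_wpDl.
have d_1 : d <= 1 by rewrite !ge_min lexx.
have d_d1 : d <= d1 by rewrite !ge_min lexx orbT.
have dA : d * A * K2 <= e.
  rewrite (@le_trans _ _ (d * ((A + 1) * K2)))//.
    by rewrite -mulrA ler_wpM2l ?(ltW d0)// ler_wpM2r ?(ltW K20)// lerDl.
  by rewrite -ler_pdivlMr ?mulr_gt0 ?ltr_wpDl// ge_min lexx orbT.
have [r1 r10 [r1U Hr1]] := C1_strictly_differentiable oU XC Ux0 d0.
have cG : {for x0, continuous G} by apply: GC.1.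
have cX : {for x0, continuous X} by apply: XC.1.
have cDG : {for x0, continuous (fun x => 'D_(X x) G x)}.
  exact: (C1_derive_continuous oU GC Ux0 (@cvg_id _ _) cX).
have /nbhs_ballP[r2 /= r20 Hr2] : \forall x \near x0, `|G x - G x0| <= d /\
    `|'D_(X x) G x - 'D_(X x0) G x0| <= d.
  near=> x; split; rewrite distrC; near: x.
    exact: (cvgrPdist_le _ _).1.
  exact: (cvgrPdist_le _ _).1.
near=> r => x y xr yr.
have rr1 : ball x0 r `<=` ball x0 r1.
  by apply: le_ball; near: r; exact: nbhs_right_le.
have rr2 : ball x0 r `<=` ball x0 r2.
  by apply: le_ball; near: r; exact: nbhs_right_le.
have [Gx DGx] := Hr2 _ (rr2 _ xr).
have Xyx := Hr1 _ _ (rr1 _ xr) (rr1 _ yr).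
set w := y - x in Xyx *.
set B := bilin (G x) w w.
have wB : `|w| ^+ 2 <= K2 * B.
  have [_ H2] := Hd1 _ (le_trans Gx d_d1) w.
  (* [G x] is not known to be positive definite here. If [B] were negative, [gnorm (G x) w] would be
     0 because [Num.sqrt] vanishes on negative numbers, and the comparison with [G x0] would force
     [w = 0]. *)
  have H3 : 0 <= B.
    rewrite leNgt; apply/negP => Bneg.
    have : gnorm (G x) w = 0 by rewrite /gnorm ler0_sqrtr// ltW.
    move=> g0; move: H2; rewrite g0 mulr0 => H2.
    have w0 : w = 0 by apply: (gnorm_eq0 pG); apply/eqP;
        rewrite eq_le H2 gnorm_ge0.
    by move: Bneg; rewrite /B w0 bilin0l ltxx.
  have -> : B = gnorm (G x) w ^+ 2 by rewrite sqr_sqrtr.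
  rewrite -exprMn lerXn2r ?nnegrE ?mulr_ge0 ?gnorm_ge0 ?(ltW K0)//.
  rewrite (le_trans (HK w))// mulrAC mulrC.
  by rewrite ler_wpM2r// ltW.
have W0 : 0 <= `|w| ^+ 2 by rewrite sqr_ge0.
have nGx : `|G x| <= `|G x0| + 1.
  rewrite -[G x](subrK (G x0)) addrC (le_trans (ler_normD _ _))//.
  by rewrite lerD2l (le_trans Gx).
have E1 : bilin (G x) (X y - X x - 'D_w X x0) w <= k * (`|G x0| + 1) * d * `|w|
    ^+ 2.
  rewrite (le_trans (ler_norm _))// (le_trans (bilin_le _ _ _))//.
  rewrite -/k expr2 !mulrA ler_wpM2r//.
  rewrite -[leRHS]mulrA ler_pM ?mulr_ge0// ler_wpM2l//.
have E2 : bilin (G x - G x0) ('D_w X x0) w <= k * K1 * d * `|w| ^+ 2.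
  rewrite (le_trans (ler_norm _))// (le_trans (bilin_le _ _ _))//.
  rewrite -/k expr2 !mulrA ler_wpM2r//.
  rewrite (_ : k * K1 * d * `|w| = (k * d) * (K1 * `|w|)); last by ring.
  by rewrite ler_pM ?mulr_ge0// ler_wpM2l.
have E3 : bilin ('D_(X x) G x - 'D_(X x0) G x0) w w <= k * d * `|w| ^+ 2.
  rewrite (le_trans (ler_norm _))// (le_trans (bilin_le _ _ _))//.
  by rewrite -/k expr2 !mulrA !ler_wpM2r// ler_wpM2l.
have E4 : C * bilin (G x0 - G x) w w <= `|C| * k * d * `|w| ^+ 2.
  rewrite (le_trans (ler_norm _))// normrM -!mulrA ler_wpM2l//.
  rewrite (le_trans (bilin_le _ _ _))// -/k -!mulrA -expr2 ler_wpM2l//.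
  by rewrite ler_wpM2r// distrC.
have := hC w; rewrite /lie => E5.
have -> : X y - X x = (X y - X x - 'D_w X x0) + 'D_w X x0 by rewrite subrK.
rewrite bilinDl; rewrite !bilinBG in E2 E3 E4; rewrite mulrDl -/B.
rewrite -/B in E4.
have E6 : d * A * `|w| ^+ 2 <= e * B.
  have B0 : 0 <= B by rewrite -(pmulr_rge0 _ K20) (le_trans W0).
  rewrite (@le_trans _ _ (d * A * (K2 * B)))//.
    by rewrite ler_wpM2l// mulr_ge0// ltW.
  by rewrite mulrA ler_wpM2r.
have kd : 0 <= k * d * `|w| ^+ 2 by rewrite !mulr_ge0// ltW.
have AE : d * A * `|w| ^+ 2 = k * (`|G x0| + 1) * d * `|w| ^+ 2
    + k * K1 * d * `|w| ^+ 2 + k * d * `|w| ^+ 2 + `|C| * k * d * `|w| ^+ 2.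
  by rewrite /A; ring.
rewrite AE in E6; rewrite mulrBr in E4.
(* The error [p3] enters with factor 1/2 but is counted in full, whence the condition [0 <= p3]. *)
have arith (x1 x2 y2 z z0 c0 cB p1 p2 p3 p4 q : R) : x1 <= p1 ->
    x2 - y2 <= p2 -> z - z0 <= p3 -> c0 - cB <= p4 -> y2 + 2^-1 * z0 <= c0 ->
    p1 + p2 + p3 + p4 <= q -> 0 <= p3 -> x1 + x2 + 2^-1 * z <= cB + q.
  by clear; move=> *; lra.
exact: arith E1 E2 E3 E4 E5 E6 kd.
Unshelve. all: by end_near. Qed.

End local_estimate.

(** * Displacement in a Riemannian manifold *)

Lemma open_chart_image (R : realType) (M : topologicalType) n (c : chart R M n)
    (V : set M) : open V -> open (cmap c @` (cdom c `&` V)).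
Proof.
move=> oV; rewrite openE => _ [p [cp Vp] <-].
have cx : (cmap c @` cdom c) (cmap c p) by exists p.
have near1 : \forall y \near cmap c p, (cmap c @` cdom c) y.
  by apply: open_nbhs_nbhs; split => //; exact: open_cimg.
have near2 : \forall y \near cmap c p, V (cinv c y).
  apply: (cinv_continuous cx); rewrite cmapK//.
  by apply: open_nbhs_nbhs; split.
near=> y.
have [q cq qy] : (cmap c @` cdom c) y by near: y.
by exists q => //; split=> //; rewrite -(cmapK cq) qy; near: y.
Unshelve. all: by end_near. Qed.

Section metric.
Variables (R : realType) (n : nat) (M : manifold R n) (g : riem_metric M).
Variable X : vector_field M.
Implicit Types (c : chart R M n) (p : M) (x v w : 'rV[R]_n).

Lemma cimg_cmap c p : cdom c p -> cimg c (cmap c p).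
Proof. by exists p. Qed.

Lemma metric_posdef_loc c x : atlas c -> cimg c x -> posdef (g c x).
Proof.
move=> ac cx; split; first exact: metric_sym.
by move=> v v0; exact: metric_posdef.
Qed.

Lemma cov_derivZ c x a w : atlas c -> cimg c x ->
  cov_deriv g X c x (a *: w) = a *: cov_deriv g X c x w.
Proof.
move=> ac cx; apply/rowP => k; rewrite !mxE mulrDr; congr (_ + _).
  by rewrite (C1_deriveZ (@open_cimg _ _ _ c) (vf_smooth X ac 1%N))// mxE.
rewrite mulr_sumr; apply: eq_bigr => i _; rewrite mulr_sumr.
by apply: eq_bigr => j _; rewrite mxE; ring.
Qed.

(* [(L_X g)(w, w) = 2 g(nabla_w X, w)], by the symmetry of the connection. *)
Lemma lie_cov_deriv c x w : atlas c -> cimg c x ->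
  bilin (g c x) ('D_w (X c) x) w + 2^-1 * bilin ('D_(X c x) (g c) x) w w =
  bilin (g c x) (cov_deriv g X c x w) w.
Proof.
move=> ac cx; set G := g c x; set Y := X c x.
pose Ga := christoffel g c x.
(* [T i j] is g(nabla_Y e_i, e_j) for the coordinate fields e_i. Compatibility with the metric makes
   the derivative of the metric along [Y] equal to [T] plus its transpose, and half of that at (w,
   w) is T(w, w). *)
pose T i j := \sum_k Y 0 k * \sum_l Ga l k i * G l j.
have gC := metric_smooth g ac 1%N; have oc := @open_cimg _ _ _ c.
have DG i j : ('D_Y (g c) x) i j = T i j + T j i.
  rewrite (C1_derive_sum oc gC)// summxE -big_split/=.
  apply: eq_bigr => k _; rewrite mxE -mulrDr; congr (_ * _).
  rewrite derive_mx; last by have [_ /(_ (delta_mx 0 k))[+ _]] := gC; exact.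
  rewrite mxE -[LHS]/(partial k (fun y => g c y i j) x) (christoffel_metric g ac
      cx).
  by rewrite big_split.
have -> : 2^-1 * bilin ('D_Y (g c) x) w w = \sum_i \sum_j w 0 i * T i j * w 0 j.
  rewrite bilinE.
  have -> : \sum_i \sum_j w 0 i * ('D_Y (g c) x) i j * w 0 j =
     \sum_i \sum_j w 0 i * T i j * w 0 j + \sum_i \sum_j w 0 i * T j i * w 0 j.
    rewrite -big_split; apply: eq_bigr => i _; rewrite -big_split.
    by apply: eq_bigr => j _ /=; rewrite DG; ring.
  rewrite [X in _ + X]exchange_big/=.
  have -> : \sum_j \sum_i w 0 i * T j i * w 0 j = \sum_i \sum_j w 0 i * T i j *
      w 0 j.
    by apply: eq_bigr => i _; apply: eq_bigr => j _; ring.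
  by field.
pose S : 'rV[R]_n := \row_k \sum_(i < n) \sum_(j < n) Ga k i j * w 0 i * Y 0 j.
have -> : cov_deriv g X c x w = 'D_w (X c) x + S.
  by apply/rowP => k; rewrite !mxE.
rewrite bilinDl; congr (_ + _); rewrite bilinE.
rewrite exchange_big [RHS]exchange_big/=; apply: eq_bigr => j _.
have -> : \sum_i S 0 i * G i j * w 0 j =
   \sum_l \sum_i \sum_k Ga l k i * w 0 i * Y 0 k * G l j * w 0 j.
  apply: eq_bigr => l _; rewrite mxE !mulr_suml; apply: eq_bigr => i _.
  rewrite !mulr_suml; apply: eq_bigr => k _.
  (* Torsion-freeness exchanges the slots of [w] and [Y], which matches the covariant derivative
     along [w] with [T]. *)
  by rewrite /Ga (christoffel_torsion_free g ac cx l k i).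
rewrite exchange_big/=; apply: eq_bigr => i _; rewrite exchange_big/=.
rewrite /T mulr_sumr mulr_suml; apply: eq_bigr => k _.
rewrite mulr_sumr mulr_sumr mulr_suml; apply: eq_bigr => l _; ring.
Qed.

(** By [lie_cov_deriv] the left-hand side is g(nabla_w X, w); Cauchy-Schwarz and the operator norm
    at [w] scaled to unit length finish. *)
Lemma nabla_norm_le p (C : R) : (nabla_norm g X p <= C%:E)%E ->
  let c := chart_at p in let x := cmap c p in forall w,
  bilin (g c x) ('D_w (X c) x) w + 2^-1 * bilin ('D_(X c x) (g c) x) w w
    <= C * bilin (g c x) w w.
Proof.
move=> hC c x w.
have ac : atlas c by exact: chart_at_atlas.
have cx : cimg c x by apply: cimg_cmap; exact: mem_chart_at.
have pG := metric_posdef_loc ac cx.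
rewrite lie_cov_deriv//.
have [->|w0] := eqVneq w 0.
  by rewrite bilinC ?pG.1// !bilin0l mulr0.
have n0 : 0 < gnorm (g c x) w.
  rewrite lt_neqAle gnorm_ge0 andbT eq_sym; apply/eqP => /(gnorm_eq0 pG)/eqP.
  by rewrite (negPf w0).
rewrite (le_trans (ler_norm _))// (le_trans (bilin_cauchy pG _ _))//.
rewrite -(gnorm_sqr pG) expr2 mulrA ler_wpM2r ?gnorm_ge0//.
have : ((gnorm (g c x) (cov_deriv g X c x ((gnorm (g c x) w)^-1 *: w)))%:E <=
    C%:E)%E.
  apply: le_trans hC; apply: ereal_sup_ubound => /=.
  exists ((gnorm (g c x) w)^-1 *: w) => //=.
  by rewrite gnormZ// normfV gtr0_norm// mulVf// gt_eqF.
rewrite lee_fin cov_derivZ// gnormZ// normfV gtr0_norm//.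
by rewrite ler_pdivrMl// mulrC.
Qed.

(* First-order bound: to first order at [s] the curve [sigma], which need not be
   differentiable, moves with speed at most [A]. *)
Definition chart_displacement c (sigma : R -> M) (s A : R) :=
  forall e, 0 < e -> \forall u \near s,
    gnorm (g c (cmap c (sigma s))) (cmap c (sigma u) - cmap c (sigma s))
      <= (A + e) * `|u - s|.

Definition displacement (sigma : R -> M) (s A : R) :=
  {for s, continuous sigma} /\
  forall c, atlas c -> cdom c (sigma s) -> chart_displacement c sigma s A.

Lemma transition_C1 c c' : atlas c -> atlas c' ->
  open (cmap c @` (cdom c `&` cdom c')) /\
  Ck_on 1 (cmap c @` (cdom c `&` cdom c')) (transition c c').
Proof.
move=> ac ac'; split; last exact: (transition_smooth ac ac' 1%N).
by apply: open_chart_image; exact: open_cdom.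
Qed.

(** One chart suffices: a change of charts differs from its differential by o(|v|), and the
    differential is an isometry between the two metric matrices. The tolerance [d] solves
    [K' * d * K * (A + e1) = e1]. *)
Lemma displacementP c sigma s A : 0 <= A -> atlas c -> cdom c (sigma s) ->
  {for s, continuous sigma} -> chart_displacement c sigma s A ->
  displacement sigma s A.
Proof.
move=> A0 ac cs cont H; split=> // c' ac' c's e e0.
set p := sigma s in cs c's *; set x := cmap c p.
have [e1 e10 eE] : exists2 e1, 0 < e1 & e = e1 + e1.
  by exists (e / 2); [rewrite divr_gt0 | field].
have pG := metric_posdef_loc ac (cimg_cmap cs).
have pG' := metric_posdef_loc ac' (cimg_cmap c's).
have [K K0 HK] := gnorm_lower pG.
have [K' K'0 HK'] := gnorm_upper pG'.
pose d := e1 / (K' * K * (A + e1)).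
have Ae : 0 < A + e1 by rewrite ltr_wpDl.
have d0 : 0 < d by rewrite divr_gt0// !mulr_gt0.
have [oT TC] := transition_C1 ac ac'.
have Tx : (cmap c @` (cdom c `&` cdom c')) x by exists p.
have [r r0 [_ Hr]] := C1_strictly_differentiable oT TC Tx d0.
have cc : {for s, continuous (cmap c \o sigma)}.
  by apply: (continuous_comp cont); exact: cmap_continuous.
near=> u.
have cu : cdom c (sigma u).
  by near: u; apply: cont; apply: open_nbhs_nbhs; split => //; exact: open_cdom.
have xu : ball x r (cmap c (sigma u)).
  by near: u; apply: cc; exact: nbhsx_ballx.
have Hu : gnorm (g c x) (cmap c (sigma u) - x) <= (A + e1) * `|u - s|.
  by near: u; exact: H.
set v := cmap c (sigma u) - x in Hu *.
have := Hr _ _ (ballxx _ r0) xu; rewrite /transition /= cmapK// /x cmapK//.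
rewrite -/x -/v; set v' := 'D_v _ x; set D := cmap c' _ - _ => HD.
have -> : D = (D - v') + v' by rewrite subrK.
rewrite (le_trans (gnormD pG' _ _))//.
have -> : gnorm (g c' (cmap c' p)) v' = gnorm (g c x) v.
  by rewrite /gnorm (metric_compat g ac ac').
have Hv : `|v| <= K * ((A + e1) * `|u - s|).
  by rewrite (le_trans (HK _))// ler_wpM2l// ltW.
rewrite (_ : (A + e) * _ = e1 * `|u - s| + (A + e1) * `|u - s|); last first.
  by rewrite eE; ring.
rewrite lerD// (le_trans (HK' _))// (le_trans (ler_wpM2l (ltW K'0) HD))//.
rewrite (le_trans (ler_wpM2l (ltW K'0) (ler_wpM2l (ltW d0) Hv)))//.
rewrite !mulrA ler_wpM2r// le_eqVlt; apply/orP; left; apply/eqP; rewrite /d.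
by field; rewrite !gt_eqF.
Unshelve. all: by end_near. Qed.

End metric.

(** * Gronwall estimate for integral curves *)

Lemma is_derive_entry (R : realType) (m n : nat) (H : R -> 'M[R]_(m, n)) (t : R)
    (dH : 'M[R]_(m, n)) i j :
  is_derive t 1 H dH -> is_derive t 1 (fun s => H s i j) (dH i j).
Proof.
move=> dHt; have dt := @ex_derive _ _ _ _ _ _ _ dHt.
split; first by apply: (derivable_mxP H t 1).1.
by rewrite -(@derive_val _ _ _ _ _ _ _ dHt) derive_mx// mxE.
Qed.

Lemma is_derive_sum_fun (R : realType) (n : nat) (h : 'I_n -> R -> R) (t : R)
    (dh : 'I_n -> R) :
  (forall i, is_derive t 1 (h i) (dh i)) ->
  is_derive t 1 (fun s => \sum_i h i s) (\sum_i dh i).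
Proof.
move=> H; have -> : (fun s => \sum_i h i s) = \sum_i h i.
  by apply/funext => s; rewrite fct_sumE.
exact: is_derive_sum.
Qed.

Lemma is_derive_bilin (R : realType) (n : nat) (H : R -> 'M[R]_n)
    (w : R -> 'rV[R]_n) (t : R) (dH : 'M[R]_n) (dw : 'rV[R]_n) :
  (H t)^T = H t -> is_derive t 1 H dH -> is_derive t 1 w dw ->
  is_derive t 1 (fun s => bilin (H s) (w s) (w s))
    (2 * bilin (H t) dw (w t) + bilin dH (w t) (w t)).
Proof.
move=> sH dHt dwt.
have -> : (fun s => bilin (H s) (w s) (w s)) =
   (fun s => \sum_i \sum_j w s 0 i * H s i j * w s 0 j).
  by apply/funext => s; rewrite bilinE.
have -> : 2 * bilin (H t) dw (w t) + bilin dH (w t) (w t) =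
    \sum_i \sum_j (w t 0 i * H t i j * dw 0 j +
      w t 0 j * (w t 0 i * dH i j + H t i j * dw 0 i)).
  rewrite mulr_natl mulr2n [X in X + _ + _](bilinC _ _ sH) !bilinE -!big_split.
  apply: eq_bigr => i _; rewrite -!big_split; apply: eq_bigr => j _ /=; ring.
apply: is_derive_sum_fun => i; apply: is_derive_sum_fun => j.
have d1 := is_derive_entry 0 i dwt.
have d2 := is_derive_entry 0 j dwt.
have d3 := is_derive_entry i j dHt.
exact: is_derive_eq.
Qed.

Lemma gronwall (R : realType) (f f' : R -> R) (a b k : R) :
  a <= b -> (forall t, a <= t <= b -> is_derive t 1 f (f' t)) ->
  (forall t, a <= t <= b -> f' t <= k * f t) ->
  f b <= f a * expR (k * (b - a)).
Proof.
move=> ab df f'k.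
pose h t := f t * expR (- k * t).
have dh t : a <= t <= b -> is_derive t 1 h ((f' t - k * f t) * expR (- k * t)).
  move=> tab; have d1 := df t tab.
  have d2 : is_derive t 1 (fun s : R => - k * s) (- k).
    have -> : (fun s : R => - k * s) = (- k) \*: (@id R) by [].
    by apply: is_derive_eq; rewrite /= -[_ *: _]/(_ * _) mulr1.
  have d3 : is_derive t 1 (expR \o (fun s : R => - k * s)) (- k * expR (- k *
      t)).
    by apply: is_derive_eq; rewrite mulrC.
  by apply: is_derive_eq; rewrite /GRing.scale/=; ring.
have hab : h b <= h a.
  apply: (@ler0_derive1_nincr R h a b) => // [x xab|x xab|].
  - by have := dh x; rewrite !ltW ?(itvP xab)// => /(_ isT) [].
  - have xab' : a <= x <= b by rewrite !ltW ?(itvP xab).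
    rewrite derive1E (@derive_val _ _ _ _ _ _ _ (dh x xab')).
    by rewrite mulr_le0_ge0 ?expR_ge0// subr_le0 f'k.
  - apply: derivable_within_continuous => x; rewrite in_itv/= => xab.
    by have [] := dh x xab.
rewrite mulrBr expRD -mulNr mulrCA -ler_pdivrMl ?expR_gt0//.
by rewrite mulrC -expRN -mulNr.
Qed.

(** The set is the image under [cinv c] of a compact ball, hence compact, hence closed since [M] is
    Hausdorff. It is used to keep limits of curves inside the chart domain. *)
Lemma closed_chart_ball (R : realType) (n : nat) (M : manifold R n)
    (c : chart R M n) (x0 : 'rV[R]_n) (r : R) : 0 < r ->
  (forall x, `|x - x0| <= r -> cimg c x) ->
  closed [set m | cdom c m /\ `|cmap c m - x0| <= r].
Proof.
move=> r0 rU; pose B := [set x : 'rV[R]_n | `|x - x0| <= r].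
have cB : compact B.
  apply: bounded_closed_compact.
    exists (`|x0| + r); split; first by rewrite num_real.
    move=> k hk x Bx /=; rewrite ltW// (le_lt_trans _ hk)//.
    by rewrite -[x](subrK x0) addrC (le_trans (ler_normD _ _))// lerD2l.
  rewrite (_ : B = closed_ball x0 r); first exact: closed_ball_closed.
  rewrite closed_ballE//; apply/seteqP.
  by split=> x; rewrite /B /closed_ball_/= distrC.
rewrite (_ : [set m | _] = cinv c @` B).
  apply: compact_closed; first exact: manifold_hausdorff.
  apply: continuous_compact cB; apply: continuous_in_subspaceT => x.
  by rewrite inE => /rU; exact: cinv_continuous.
apply/seteqP; split=> [m [cm Bm]|_ [x Bx <-]] /=.
  by exists (cmap c m) => //; rewrite cmapK.
by have [m cm mx] := rU _ Bx; move: Bx; rewrite -mx cmapK.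
Qed.

Section chart_gronwall.
Variables (R : realType) (n : nat) (M : manifold R n) (g : riem_metric M).
Variables (X : vector_field M) (c : chart R M n) (p q : R -> M).
Hypothesis ac : atlas c.
Let G := g c.
Let w t := cmap c (q t) - cmap c (p t).

(** Gronwall for the squared length of [w], measured at the end [p t]: its derivative is twice the
    left-hand side of the hypothesis, and the square root turns the rate [2 * C] into [C]. *)
Lemma integral_curve_gronwall (a b C : R) : a <= b ->
  (forall t, a <= t <= b -> [/\ cdom c (p t), cdom c (q t),
    is_derive t 1 (cmap c \o p) (X c (cmap c (p t))) &
    is_derive t 1 (cmap c \o q) (X c (cmap c (q t)))]) ->
  (forall t, a <= t <= b -> let x := cmap c (p t) in
    bilin (G x) (X c (cmap c (q t)) - X c x) (w t)
      + 2^-1 * bilin ('D_(X c x) G x) (w t) (w t) <= C * bilin (G x) (w t) (w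
          t)) ->
  gnorm (G (cmap c (p b))) (w b) <=
    gnorm (G (cmap c (p a))) (w a) * expR (C * (b - a)).
Proof.
move=> ab H hC.
have posG t : a <= t <= b -> posdef (G (cmap c (p t))).
  by move=> /H[pt _ _ _]; apply: metric_posdef_loc => //; exact: cimg_cmap.
rewrite -(@ler_pXn2r _ 2) ?nnegrE ?mulr_ge0 ?gnorm_ge0 ?expR_ge0//.
rewrite exprMn !gnorm_sqr; try by apply: posG; rewrite ?lexx ab.
have -> : expR (C * (b - a)) ^+ 2 = expR ((2 * C) * (b - a)).
  by rewrite -expRM_natl; congr expR; ring.
pose f t := bilin (G (cmap c (p t))) (w t) (w t).
pose x := cmap c \o p.
pose f' t := 2 * bilin (G (x t)) (X c (cmap c (q t)) - X c (x t)) (w t)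
   + bilin ('D_(X c (x t)) G (x t)) (w t) (w t).
apply: (@gronwall _ f f') => // t tab; last first.
  by have := hC t tab; rewrite /f' /f /x /=; lra.
have [pt qt dp dq] := H t tab.
have dG : is_derive t 1 (G \o x) ('D_(X c (x t)) G (x t)).
  apply: (C1_comp_is_derive (@open_cimg _ _ _ c) (metric_smooth g ac 1%N)) =>
      //.
  exact: cimg_cmap.
have dw : is_derive t 1 w (X c (cmap c (q t)) - X c (x t)) by exact: is_deriveB.
exact: (is_derive_bilin (posG t tab).1 dG dw).
Qed.

(** The Gronwall bound requires [q] to stay in the chart, and [q] stays there because of the bound;
    continuous induction breaks the circle. With [p] within [r / 4] of [x0] and a chord shorter than
    [r / 4], [q] remains in the ball of radius [r / 2], inside the region where the estimates
    hold. *)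
Lemma integral_curve_trap (a b C K r : R) (x0 : 'rV[R]_n) :
  a <= b -> 0 <= C -> 0 < K -> 0 < r -> ball x0 r `<=` cimg c ->
  (forall x y, ball x0 r x -> ball x0 r y ->
    bilin (G x) (X c y - X c x) (y - x)
      + 2^-1 * bilin ('D_(X c x) G x) (y - x) (y - x)
    <= C * bilin (G x) (y - x) (y - x)) ->
  (forall x v, ball x0 r x -> `|v| <= K * gnorm (G x) v) ->
  (forall t, a <= t <= b ->
    cdom c (p t) /\ ball x0 (r / 4) (cmap c (p t))) ->
  integral_curve X `[a, b] p -> integral_curve X `[a, b] q ->
  cdom c (q a) ->
  K * (gnorm (G (cmap c (p a))) (w a) * expR (C * (b - a))) < r / 4 ->
  [/\ cdom c (q b), `|w b| < r / 4 & gnorm (G (cmap c (p b))) (w b) <=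
    gnorm (G (cmap c (p a))) (w a) * expR (C * (b - a))].
Proof.
move=> ab C0 K0 r0 rU hC hK hp ip iq qa small.
have r40 : 0 < r / 4 by rewrite divr_gt0.
pose B := [set x : 'rV[R]_n | `|x - x0| <= r / 2].
have B_r x : B x -> ball x0 r x.
  rewrite /B/= -ball_normE /ball_/= distrC => /le_lt_trans; apply.
  by rewrite ltr_pdivrMr// ltr_pMr// ltr1n.
pose L := [set m | cdom c m /\ B (cmap c m)].
have clL : closed L.
  apply: closed_chart_ball; first by rewrite divr_gt0.
  by move=> x Bx; apply: rU; exact: B_r.
have pr t : a <= t <= b -> ball x0 r (cmap c (p t)).
  move=> /hp[_]; apply: le_ball; rewrite ler_pdivrMr// ler_pMr// ler1n//.
have bd t : a <= t <= b -> cdom c (p t) -> cdom c (q t) ->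
    [/\ cdom c (p t), cdom c (q t),
    is_derive t 1 (cmap c \o p) (X c (cmap c (p t))) &
    is_derive t 1 (cmap c \o q) (X c (cmap c (q t)))].
  move=> tab cp cq; have t' : `[a, b]%classic t by rewrite /= in_itv.
  by split=> //; [apply: (ip t t').2 | apply: (iq t t').2].
pose T t := cdom c (q t) /\ `|w t| < r / 4.
have TB t : a <= t <= b -> T t -> B (cmap c (q t)).
  move=> /hp[_ H1] [_ H2];
      rewrite /B/= -(subrK (cmap c (p t)) (cmap c (q t))) -addrA.
  rewrite (le_trans (ler_normD _ _))//.
  move: H1; rewrite -ball_normE /ball_/= distrC => H1.
  rewrite /w in H2; lra.
have grow t : a <= t <= b -> (forall u, a <= u <= t -> cdom c (q u) /\ B (cmap c
    (q u))) ->
    gnorm (G (cmap c (p t))) (w t) <=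
    gnorm (G (cmap c (p a))) (w a) * expR (C * (t - a)).
  move=> /andP[at_ tb] H; apply: integral_curve_gronwall => // u /andP[au ut].
    have uab : a <= u <= b by rewrite au (le_trans ut).
    apply: bd => //; first exact: (hp u uab).1.
    by apply: (H u _).1; rewrite au.
  apply: hC; first by apply: pr; rewrite au (le_trans ut).
  by apply: B_r; apply: (H u _).2; rewrite au.
have grow' t : a <= t <= b -> gnorm (G (cmap c (p t))) (w t) <=
    gnorm (G (cmap c (p a))) (w a) * expR (C * (t - a)) -> `|w t| < r / 4.
  move=> tab H; apply: le_lt_trans small;
      rewrite (le_trans (hK _ _ (pr t tab)))//.
  rewrite ler_wpM2l ?(ltW K0)// (le_trans H)// ler_wpM2l ?gnorm_ge0//.
  by rewrite ler_expR ler_wpM2l// lerB//; case/andP: tab.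
have Tall : forall t, a <= t <= b -> T t.
  apply: real_induction => //.
  - split=> //; apply: grow'; first by rewrite lexx.
    by rewrite subrr mulr0 expR0 mulr1.
  - move=> t /andP[at_ tb] /(_ t); rewrite at_ lexx => /(_ isT)[qt wt].
    have tab : a <= t <= b by rewrite at_ ltW.
    have t' : `[a, b]%classic t by rewrite /= in_itv.
    have cq := (iq t t').1; have cp := (ip t t').1.
    have [cpt _] := hp t tab.
    near=> u; move=> _; split.
      by near: u; apply: cq; apply: open_nbhs_nbhs; split => //;
          exact: open_cdom.
    near: u.
    have cw : {for t, continuous w}.
      apply: cvgB.
        exact: (continuous_comp cq (cmap_continuous qt)).
      exact: (continuous_comp cp (cmap_continuous cpt)).
    have : {for t, continuous (fun u => `|w u|)} by exact: cvg_norm.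
    by move=> cn; apply: cvgr_lt cn _ _.
  - move=> t /andP[at_ tb] IH.
    have tab : a <= t <= b by rewrite tb ltW.
    have t' : `[a, b]%classic t by rewrite /= in_itv.
    have cq := (iq t t').1.
    (* Continuity alone would allow [q] to leave the open chart domain exactly at time [t];
       closedness of [L] excludes this. *)
    have Lt : L (q t).
      apply: (@closed_cvg _ _ (t^'-) _ q L clL) => //; last first.
        exact: (cvg_at_left_filter cq).
      near=> u.
      have uab : a <= u < t.
        by apply/andP; split; near: u;
            [exact: nbhs_left_ge | exact: nbhs_left_lt].
      have Tu := IH u uab.
      have Bu : B (cmap c (q u)).
        by apply: TB => //; move: uab => /andP[-> /ltW/le_trans]; exact.
      by split=> //; exact: Tu.1.
    have [qt Bt] := Lt; split=> //; apply: grow' => //; apply: grow => // u.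
    move=> /andP[au]; rewrite le_eqVlt => /orP[/eqP -> //|ut].
    have Tu : T u by apply: IH; rewrite au.
    split; first exact: Tu.1.
    by apply: TB => //; rewrite au ltW// (lt_le_trans ut).
have [qb wb] : T b by apply: Tall; rewrite ab lexx.
split=> //; apply: grow; first by rewrite ab lexx.
move=> u uab; have Tu := Tall u uab; split; first exact: Tu.1.
exact: TB.
Unshelve. all: by end_near. Qed.

End chart_gronwall.

Lemma near_dist_lt (R : realType) (x k : R) :
  0 < k -> \forall y \near x, `|y - x| < k.
Proof.
move=> k0; have : nbhs x (ball x k) by exact: nbhsx_ballx.
by apply: filterS => y; rewrite /ball/= distrC.
Qed.

Section flow.
Variables (R : realType) (n : nat) (M : manifold R n) (g : riem_metric M).
Variables (X : vector_field M) (D : M -> set R) (Fl : R -> M -> M).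
Variables (A : set M) (T C : R).
Hypothesis flX : is_flow X D Fl.
Hypothesis AD : forall p t, A p -> 0 <= t <= T -> D p t.
Hypothesis C0 : 0 <= C.
Hypothesis hC : forall q, flow_image Fl T A q -> (nabla_norm g X q <= C%:E)%E.

Lemma flow0 p : Fl 0 p = p.
Proof. by have [[_ _ _ ->]] := flX p. Qed.

Lemma flow_integral_curve p a b : A p -> 0 <= a -> b <= T ->
  integral_curve X `[a, b] (Fl ^~ p).
Proof.
move=> Ap a0 bT t /=; rewrite in_itv/= => /andP[at_ tb].
have [[_ _ _ _ ic] _] := flX p; apply: ic; apply: AD => //.
by rewrite (le_trans a0)//= (le_trans tb).
Qed.

(** Both [a] and [b] are free near [t0]: the induction on time takes [a = t0] to advance beyond [t0]
    and [b = t0] to arrive at it from the left. *)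
Lemma flow_displacement_local (sigma : R -> M) (s t0 e : R) :
  (\forall u \near s, A (sigma u)) -> 0 <= t0 <= T -> 0 < e ->
  exists2 d, 0 < d & forall a b B, 0 <= a -> a <= b -> b <= T ->
    `|a - t0| < d -> `|b - t0| < d -> 0 <= B ->
    displacement g (fun u => Fl a (sigma u)) s B ->
    displacement g (fun u => Fl b (sigma u)) s (B * expR ((C + e) * (b - a))).
Proof.
move=> nA t0T e0.
have As : A (sigma s) by exact: nbhs_singleton nA.
pose p t := Fl t (sigma s); pose c := chart_at (p t0).
have ac : atlas c by exact: chart_at_atlas.
have cp0 : cdom c (p t0) by exact: mem_chart_at.
pose x0 := cmap c (p t0); have cx0 : cimg c x0 by exact: cimg_cmap.
have oc := @open_cimg _ _ _ c.
have pG0 := metric_posdef_loc g ac cx0.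
have [K K0 HK] := gnorm_lower pG0.
have [d1 d10 Hd1] := gnorm_compare pG0 ltr01.
have lie := lie_estimate oc (vf_smooth X ac 1%N) (metric_smooth g ac 1%N) cx0
  pG0 (nabla_norm_le (hC _)) e0.
have {}lie := lie (ex_intro _ t0 (ex_intro _ (sigma s) (And3 t0T As erefl))).
have [r [r0 rU Hlie HKr]] : exists r, [/\ 0 < r, ball x0 r `<=` cimg c,
  (forall x y, ball x0 r x -> ball x0 r y ->
    bilin (g c x) (X c y - X c x) (y - x)
      + 2^-1 * bilin ('D_(X c x) (g c) x) (y - x) (y - x)
    <= (C + e) * bilin (g c x) (y - x) (y - x)) &
  (forall x v, ball x0 r x -> `|v| <= (2 * K) * gnorm (g c x) v)].
  have /nbhs_ballP[r1 r10 Hr1] : nbhs x0 (cimg c) by apply: open_nbhs_nbhs.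
  have /nbhs_ballP[r2 r20 Hr2] : \forall x \near x0, `|g c x - g c x0| <= d1.
    near=> x; rewrite distrC; near: x.
    have [cG _] := metric_smooth g ac 1%N.
    exact: ((cvgrPdist_le _ _).1 (cG _ cx0)).
  near (0 : R)^'+ => r; exists r; split.
  - by near: r; exact: nbhs_right_gt.
  - apply: subset_trans Hr1; apply: le_ball; near: r; exact: nbhs_right_le.
  - by near: r.
  - move=> x v xr.
    have /Hr2 xd : ball x0 r2 x.
      apply: (le_ball _ xr); near: r; exact: nbhs_right_le.
    have [_ H] := Hd1 _ xd v; rewrite (le_trans (HK v))//.
    by rewrite [2 * K]mulrC -mulrA ler_wpM2l// ltW.
have [d d0 Hd] : exists2 d, 0 < d & forall t, `|t - t0| < d ->
    cdom c (p t) /\ ball x0 (r / 4) (cmap c (p t)).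
  have [[_ _ _ _ ic] _] := flX (sigma s).
  have cp : {for t0, continuous p} by exact: (ic _ (AD As t0T)).1.
  have /nbhs_ballP[d d0 Hd] : \forall t \near t0,
      cdom c (p t) /\ ball x0 (r / 4) (cmap c (p t)).
    near=> t; split; near: t.
      by apply: cp; apply: open_nbhs_nbhs; split => //; exact: open_cdom.
    have cc : {for t0, continuous (cmap c \o p)}.
      by apply: (continuous_comp cp); exact: cmap_continuous.
    by apply: cc; apply: nbhsx_ballx; rewrite divr_gt0.
  by exists d => // t td; apply: Hd; rewrite /ball/= distrC.
exists d => // a b B a0 ab bT ad bd B0 [conta HB].
have Ce0 : 0 <= C + e by rewrite addr_ge0// ltW.
have K20 : 0 < 2 * K by rewrite mulr_gt0.
have hp t : a <= t <= b -> cdom c (p t) /\ ball x0 (r / 4) (cmap c (p t)).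
  move=> /andP[at_ tb]; apply: Hd; move: ad bd; rewrite !ltr_norml; lra.
have [cpa xa] : cdom c (p a) /\ ball x0 (r / 4) (cmap c (p a)).
  by apply: hp; rewrite lexx.
have [cpb xb] : cdom c (p b) /\ ball x0 (r / 4) (cmap c (p b)).
  by apply: hp; rewrite lexx ab.
pose E := expR ((C + e) * (b - a)); have E0 : 0 < E by exact: expR_gt0.
(* The displacement at time [a], taken with error 1, gives the crude factor [B + 1]. This is enough
   for the smallness that [integral_curve_trap] asks for and for continuity at time [b]; the third
   clause keeps the sharp comparison. *)
have trap : \forall u \near s, [/\ cdom c (Fl b (sigma u)),
    `|cmap c (Fl b (sigma u)) - cmap c (p b)|
      <= 2 * K * ((B + 1) * `|u - s| * E) &
    gnorm (g c (cmap c (p b))) (cmap c (Fl b (sigma u)) - cmap c (p b)) <=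
    gnorm (g c (cmap c (p a))) (cmap c (Fl a (sigma u)) - cmap c (p a)) * E].
  near=> u.
  have Au : A (sigma u) by near: u.
  have ca : cdom c (Fl a (sigma u)).
    by near: u; apply: conta; apply: open_nbhs_nbhs; split => //;
        exact: open_cdom.
  have Ha : gnorm (g c (cmap c (p a))) (cmap c (Fl a (sigma u)) - cmap c (p a))
      <= (B + 1) * `|u - s|.
    by near: u; exact: (HB c ac cpa _ ltr01).
  have small : 2 * K * ((B + 1) * `|u - s| * E) < r / 4.
    rewrite [ltLHS](_ : _ = `|u - s| * (2 * K * (B + 1) * E)); last by ring.
    rewrite -ltr_pdivlMr ?mulr_gt0 ?ltr_wpDl//; near: u.
    apply: near_dist_lt; rewrite !divr_gt0 ?mulr_gt0 ?ltr_wpDl//.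
  have [] := @integral_curve_trap _ _ _ g X c p (Fl ^~ (sigma u)) ac a b (C + e)
      (2 * K) r x0 ab Ce0 K20 r0 rU Hlie HKr hp
      (flow_integral_curve As a0 bT) (flow_integral_curve Au a0 bT) ca.
    apply: le_lt_trans small; rewrite -/E ler_wpM2l ?(ltW K20)//.
    by rewrite ler_wpM2r// ltW.
  move=> cb wb Hb; split=> //.
  rewrite (le_trans (HKr (cmap c (p b)) _ _))//.
    by apply: le_ball xb; rewrite ler_pdivrMr// ler_pMr// ler1n.
  by rewrite ler_wpM2l ?(ltW K20)// (le_trans Hb)// ler_wpM2r// ltW.
apply: (@displacementP _ _ _ _ c) => //; first by rewrite mulr_ge0 ?expR_ge0.
(* Continuity at time [b] is proved in coordinates and carried back to [M] by [cinv c]. *)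
- have cvgb : cmap c (Fl b (sigma u)) @[u --> s] --> cmap c (p b).
    apply/cvgrPdist_le => e1 e10; near=> u.
    have [_ H _] : [/\ cdom c (Fl b (sigma u)),
      `|cmap c (Fl b (sigma u)) - cmap c (p b)|
        <= 2 * K * ((B + 1) * `|u - s| * E) &
      gnorm (g c (cmap c (p b))) (cmap c (Fl b (sigma u)) - cmap c (p b)) <=
      gnorm (g c (cmap c (p a))) (cmap c (Fl a (sigma u)) - cmap c (p a)) * E].
      by near: u.
    rewrite distrC (le_trans H)//.
    rewrite [leLHS](_ : _ = `|u - s| * (2 * K * (B + 1) * E)); last by ring.
    rewrite -ler_pdivlMr ?mulr_gt0 ?ltr_wpDl// ltW//; near: u.
    apply: near_dist_lt; rewrite !divr_gt0 ?mulr_gt0 ?ltr_wpDl//.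
  have : cinv c (cmap c (Fl b (sigma u))) @[u --> s] --> cinv c (cmap c (p b)).
    apply: (cvg_comp _ _ cvgb); apply: cinv_continuous; exact: cimg_cmap.
  rewrite cmapK// => H; apply: cvg_trans H; apply: near_eq_cvg.
  by apply: filterS trap => u [cb _ _]; rewrite cmapK.
- move=> e1 e10; near=> u.
  have [_ _ H] : [/\ cdom c (Fl b (sigma u)),
      `|cmap c (Fl b (sigma u)) - cmap c (p b)|
        <= 2 * K * ((B + 1) * `|u - s| * E) &
      gnorm (g c (cmap c (p b))) (cmap c (Fl b (sigma u)) - cmap c (p b)) <=
      gnorm (g c (cmap c (p a))) (cmap c (Fl a (sigma u)) - cmap c (p a)) * E].
    by near: u.
  rewrite (le_trans H)// -/E -ler_pdivlMr//.
  (* The error requested at time [a] is [e1 / E], since the flow multiplies it by [E]. *)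
  rewrite (_ : _ / E = (B + e1 / E) * `|u - s|); last first.
    by field; rewrite gt_eqF.
  by near: u; apply: (HB c ac cpa); rewrite divr_gt0.
Unshelve. all: by end_near. Qed.

Lemma flow_displacement (sigma : R -> M) (s B t e : R) :
  (\forall u \near s, A (sigma u)) -> 0 <= t <= T -> 0 < e -> 0 <= B ->
  displacement g sigma s B ->
  displacement g (fun u => Fl t (sigma u)) s (B * expR ((C + e) * t)).
Proof.
move=> nA tT e0 B0 HB.
pose P t := displacement g (fun u => Fl t (sigma u)) s (B * expR ((C + e) * t)).
have B1 x : 0 <= B * expR x by rewrite mulr_ge0 ?expR_ge0.
have step a b : displacement g (fun u => Fl b (sigma u)) s
    (B * expR ((C + e) * a) * expR ((C + e) * (b - a))) -> P b.
  rewrite -mulrA -expRD -mulrDr addrCA subrr addr0; exact.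
have T0 : 0 <= T by case/andP: tT => /le_trans; apply.
apply: (@real_induction R 0 T P) => //.
- rewrite /P mulr0 expR0 mulr1.
  by under [fun u => _]funext => u do rewrite flow0.
- move=> x /andP[x0 xT] /(_ x); rewrite x0 lexx => /(_ isT) Px.
  have [|d d0 Hd] := @flow_displacement_local sigma s x e nA _ e0.
    by rewrite x0 ltW.
  near=> y => xy.
  have yd : `|y - x| < d by near: y; exact: near_dist_lt.
  have yT : y <= T.
    have : `|y - x| < T - x by near: y; apply: near_dist_lt; rewrite subr_gt0.
    by rewrite ltr_norml => /andP[_]; rewrite ltrBlDr subrK => /ltW.
  apply: (step x); apply: Hd => //; first exact: ltW.
  by rewrite subrr normr0.
- move=> x /andP[x0 xT] IH.
  have [|d d0 Hd] := @flow_displacement_local sigma s x e nA _ e0.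
    by rewrite xT ltW.
  (* Any earlier time closer than [d] would do; the maximum keeps it nonnegative. *)
  pose y := Num.max 0 (x - d / 2).
  have y0 : 0 <= y by rewrite le_max lexx.
  have yx : y < x by rewrite gt_max x0/=; lra.
  have yd : x - d / 2 <= y by rewrite le_max lexx orbT.
  apply: (step y); apply: Hd => //; first exact: ltW.
  + by rewrite ltr_norml; lra.
  + by rewrite subrr normr0.
  + by apply: IH; rewrite y0.
Unshelve. all: by end_near. Qed.

End flow.

(** * Curves *)

Lemma cvg_bilin (R : realType) (n : nat) (T : topologicalType) (t : T)
    (G : T -> 'M[R]_n) (v : T -> 'rV[R]_n) :
  {for t, continuous G} -> {for t, continuous v} ->
  {for t, continuous (fun s => bilin (G s) (v s) (v s))}.
Proof.
move=> cG cv.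
have -> : (fun s => bilin (G s) (v s) (v s)) =
   (fun s => \sum_i \sum_j v s 0 i * G s i j * v s 0 j).
  by apply/funext => s; rewrite bilinE.
have cvi i : (fun s => v s 0 i) @ t --> v t 0 i.
  exact: (continuous_comp cv (@coord_continuous _ _ _ _ _ _)).
apply: (@cvg_big _ _ +%R 0) => [|i _]; first exact: add_continuous.
apply: (@cvg_big _ _ +%R 0) => [|j _]; first exact: add_continuous.
apply: cvgM => //; apply: cvgM => //.
exact: (continuous_comp cG (@coord_continuous _ _ _ _ _ _)).
Qed.

Section curves.
Variables (R : realType) (n : nat) (M : manifold R n) (g : riem_metric M).
Implicit Types (sigma : R -> M) (c : chart R M n).

Definition C1_at sigma (t : R) := (\forall s \near t, {for s, continuous sigma})
    /\
  exists c, [/\ atlas c, cdom c (sigma t),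
    \forall s \near t, derivable (cmap c \o sigma) s 1 &
    {for t, continuous (fun s => 'D_1 (cmap c \o sigma) s)}].

Lemma near_cdom c sigma t : {for t, continuous sigma} -> cdom c (sigma t) ->
  \forall s \near t, cdom c (sigma s).
Proof.
by move=> cs ct; apply: cs; apply: open_nbhs_nbhs; split => //;
    exact: open_cdom.
Qed.

(** [speed] is evaluated in [chart_at], which may change from point to point; its continuity can
    only be seen in a fixed chart. *)
Lemma speed_chart c sigma s : atlas c -> {for s, continuous sigma} ->
  cdom c (sigma s) -> derivable (cmap c \o sigma) s 1 ->
  speed g sigma s =
    gnorm (g c (cmap c (sigma s))) ('D_1 (cmap c \o sigma) s).
Proof.
move=> ac cont cs ds; rewrite /speed; set c' := chart_at (sigma s).
have ac' : atlas c' by exact: chart_at_atlas.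
have c's : cdom c' (sigma s) by exact: mem_chart_at.
have [oT TC] := transition_C1 ac ac'.
have dT := C1_comp_is_derive oT TC
  (ex_intro2 _ _ _ (conj cs c's) erefl) (derivableP ds).
have -> : 'D_1 (cmap c' \o sigma) s =
    'D_('D_1 (cmap c \o sigma) s) (transition c c') (cmap c (sigma s)).
  rewrite -(@derive_val _ _ _ _ _ _ _ dT); apply: near_eq_derive.
  by apply: filterS (near_cdom cont cs) => u cu;
      rewrite /= /transition /= cmapK.
by rewrite /gnorm (metric_compat g ac ac').
Qed.

Lemma C1_speed_continuous sigma t :
  C1_at sigma t -> {for t, continuous (speed g sigma)}.
Proof.
move=> [conts [c [ac ct dc cD]]].
have cont : {for t, continuous sigma} by exact: nbhs_singleton conts.
have cc : {for t, continuous (cmap c \o sigma)}.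
  by apply: (continuous_comp cont); exact: cmap_continuous.
have E : \forall s \near t, gnorm (g c (cmap c (sigma s))) ('D_1 (cmap c \o
    sigma) s) =
    speed g sigma s.
  near=> s; apply/esym/(speed_chart ac).
  - by near: s.
  - by near: s; exact: near_cdom.
  - by near: s.
have H : {for t, continuous (fun s => gnorm (g c (cmap c (sigma s)))
    ('D_1 (cmap c \o sigma) s))}.
  rewrite /gnorm; apply: (@continuous_comp _ _ _
    (fun s => bilin (g c (cmap c (sigma s))) ('D_1 (cmap c \o sigma) s)
      ('D_1 (cmap c \o sigma) s)) (@Num.sqrt R)); last exact: sqrt_continuous.
  apply: cvg_bilin => //.
  have [cG _] := metric_smooth g ac 1%N.
  by apply: (@continuous_comp _ _ _ (cmap c \o sigma) (g c)) => //; apply: cG;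
     exact: cimg_cmap.
rewrite /prop_for /continuous_at -(nbhs_singleton E).
by apply: cvg_trans H; exact: near_eq_cvg.
Unshelve. all: by end_near. Qed.

Lemma C1_displacement sigma t :
  C1_at sigma t -> displacement g sigma t (speed g sigma t).
Proof.
move=> [conts [c [ac ct dc _]]].
have cont : {for t, continuous sigma} by exact: nbhs_singleton conts.
have dt : derivable (cmap c \o sigma) t 1 by exact: nbhs_singleton dc.
apply: (@displacementP _ _ _ _ c) => //; first exact: gnorm_ge0.
move=> e e0; rewrite (@speed_chart c)//.
set v := 'D_1 (cmap c \o sigma) t; set G := g c _.
have pG : posdef G by apply: metric_posdef_loc => //; exact: cimg_cmap.
have [K K0 HK] := gnorm_upper pG.
near=> u.
have H : `|cmap c (sigma u) - cmap c (sigma t) - (u - t) *: v| <= e / K * `|u -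
    t|.
  near: u; apply: (is_derive_near (f := cmap c \o sigma));
      last by rewrite divr_gt0.
  exact: derivableP.
rewrite -[X in gnorm _ X](subrK ((u - t) *: v)) (le_trans (gnormD pG _ _))//.
rewrite gnormZ// addrC mulrDl [gnorm G v * _]mulrC lerD2l.
rewrite (le_trans (HK _))// (le_trans (ler_wpM2l (ltW K0) H))// mulrA.
by rewrite mulrCA divff ?gt_eqF// mulr1.
Unshelve. all: by end_near. Qed.

End curves.

Lemma smooth_map_C1_at (R : realType) (k n : nat) (N : manifold R k)
    (M : manifold R n) (f : N -> M) (J : set R) (delta : R -> N) (t : R) :
  smooth_map f -> open J -> smooth_curve_on J delta -> J t ->
  C1_at (f \o delta) t.
Proof.
move=> [cf sf] oJ [cd sd] Jt.
have nJ : \forall s \near t, J s by apply: open_nbhs_nbhs.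
split.
  apply: filterS nJ => s Js; apply: (@continuous_comp _ _ _ delta f).
    exact: cd.
  exact: cf.
pose b := chart_at (delta t); pose c := chart_at (f (delta t)).
have ab : atlas b by exact: chart_at_atlas.
have ac : atlas c by exact: chart_at_atlas.
have bt : cdom b (delta t) by exact: mem_chart_at.
have ct : cdom c (f (delta t)) by exact: mem_chart_at.
pose V := cmap b @` (cdom b `&` f @^-1` cdom c).
pose F := cmap c \o f \o cinv b.
have oV : open V.
  apply: open_chart_image; apply: open_comp => [x _|]; first exact: cf.
  exact: open_cdom.
have FC : Ck_on 1 V F := sf b c ab ac 1%N.
have [_ /(_ 1)[dx [cDx _]]] := sd b ab 1%N.
have cfd s : J s -> {for s, continuous (f \o delta)}.
  by move=> Js; apply: (@continuous_comp _ _ _ delta f); [exact: cd|exact: cf].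
have near_c : \forall s \near t, cdom c (f (delta s)).
  exact: (near_cdom (cfd _ Jt)).
have near_b : \forall s \near t, cdom b (delta s) by exact: (near_cdom (cd _
    Jt)).
have E : \forall s \near t, is_derive (s : R) (1 : R) (cmap c \o (f \o delta))
    ('D_('D_1 (cmap b \o delta) s) F (cmap b (delta s))).
  near=> s.
  have Js : J s by near: s.
  have bs : cdom b (delta s) by near: s.
  have cs : cdom c (f (delta s)) by near: s.
  have Vs : V (cmap b (delta s)) by exists (delta s).
  have ds : derivable (cmap b \o delta) s 1 by apply: dx.
  have := C1_comp_is_derive oV FC Vs (derivableP ds).
  apply: near_eq_is_derive.
  apply: filterS (near_cdom (cd _ Js) bs) => u bu.
  by rewrite /F /= cmapK.
exists c; split => //; first by apply: filterS E => s [].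
have H : {for t, continuous (fun s => 'D_('D_1 (cmap b \o delta) s) F (cmap b
    (delta s)))}.
  apply: (C1_derive_continuous oV FC) => //.
  - by exists (delta t).
  - apply: (@continuous_comp _ _ _ delta (cmap b)); first exact: cd.
    exact: cmap_continuous.
  - by apply: cDx.
rewrite /prop_for /continuous_at (@derive_val _ _ _ _ _ _ _ (nbhs_singleton E)).
apply: cvg_trans H; apply: near_eq_cvg.
by apply: filterS E => s Es; rewrite (@derive_val _ _ _ _ _ _ _ Es).
Unshelve. all: by end_near. Qed.

Lemma smooth_map_id (R : realType) (n : nat) (M : manifold R n) :
  smooth_map (@id M).
Proof. by split=> [x //|c c']; exact: transition_smooth. Qed.

(** * Integrals over intervals and accumulation of a pointwise rate *)

Section interval_integral.
Variable R : realType.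
Notation mu := (@lebesgue_measure R).
Implicit Types (f h : R -> R) (a b c : R).

Lemma integral_itv_add f a b c : a <= b <= c -> (forall x, 0 <= f x) ->
  measurable_fun `[a, c] f ->
  (\int[mu]_(x in `[a, c]) (f x)%:E =
   \int[mu]_(x in `[a, b]) (f x)%:E + \int[mu]_(x in `[b, c]) (f x)%:E)%E.
Proof.
move=> /andP[ab bc] f0 mf.
have E : `[a, c]%classic = `[a, b]%classic `|` `]b, c]%classic.
  by rewrite -itv_bndbnd_setU// bnd_simp.
have mbc : measurable_fun `]b, c] f.
  by apply: measurable_funS mf => //; apply: subset_itvr; rewrite bnd_simp.
rewrite E ge0_integral_setU//=.
- by rewrite integral_itv_obnd_cbnd//; exact/measurable_EFinP.
- by rewrite -E; exact/measurable_EFinP.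
- by move=> x _; rewrite lee_fin.
- apply/disj_setPS => y [/=]; rewrite 2!in_itv/= => /andP[_ yx] /andP[].
  by rewrite ltNge yx.
Qed.

(** Agreement is required on the open interval only, because [speed] is arbitrary at break
    points. *)
Lemma integral_itv_eq f h a b : {in `]a, b[, f =1 h} ->
  measurable_fun `]a, b[ h ->
  measurable_fun `[a, b] f /\
  (\int[mu]_(x in `[a, b]) (f x)%:E = \int[mu]_(x in `[a, b]) (h x)%:E)%E.
Proof.
move=> fh mh.
have mf : measurable_fun `]a, b[ f.
  apply: eq_measurable_fun mh => x; rewrite inE => xab.
  by rewrite fh.
split; first exact: measurable_fun_itv_cc mf.
have open_cc k : measurable_fun `]a, b[ k ->
    (\int[mu]_(x in `[a, b]) (k x)%:E = \int[mu]_(x in `]a, b[) (k x)%:E)%E.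
  move=> mk; rewrite -integral_itv_obnd_cbnd; last first.
    by apply/measurable_EFinP; exact: measurable_fun_itv_oc mk.
  by rewrite -integral_itv_bndo_bndc//; exact/measurable_EFinP.
rewrite !open_cc//; apply: eq_integral => x; rewrite inE => xab.
by rewrite fh.
Qed.

Lemma continuous_itv_integrable f a b :
  (forall s, a <= s <= b -> {for s, continuous f}) ->
  mu.-integrable `[a, b] (EFin \o f).
Proof.
move=> cf; apply: continuous_compact_integrable; first exact: segment_compact.
apply: continuous_in_subspaceT => x; rewrite inE/= in_itv/=; exact: cf.
Qed.

(** [Q s L] reads: cost [L] suffices at [s]. The step is assumed in both directions because the rate
    is known around [s] only: the induction leaves [s] to the right with the first half, and arrives
    at [s] from some [y < s] with the second. *)
Lemma creep (Q : R -> R -> Prop) f a b L :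
  a <= b -> (forall s, a <= s <= b -> {for s, continuous f}) ->
  (forall s L L', L <= L' -> Q s L -> Q s L') ->
  (forall s e, a <= s <= b -> 0 < e -> \forall y \near s, forall L,
    (Q s L -> Q y (L + (f s + e) * `|y - s|)) /\
    (Q y L -> Q s (L + (f s + e) * `|y - s|))) ->
  Q a L -> forall e, 0 < e ->
  Q b (L + \int[mu]_(x in `[a, b]) f x + e).
Proof.
move=> ab cf Qmono Qstep Qa e e0.
pose F s := \int[mu]_(x in `[a, s]) f x.
have F_ge s y k : a <= s -> s <= y -> y <= b -> (forall z, s <= z <= y -> k <= f
    z) ->
    k * (y - s) <= F y - F s.
  move=> as_ sy yb kf.
  have iy : mu.-integrable `[a, y] (EFin \o f).
    apply: continuous_itv_integrable => z /andP[az zy]; apply: cf.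
    by rewrite az (le_trans zy).
  rewrite /F Rintegral_itvB ?bnd_simp//.
  have isy : mu.-integrable `]s, y] (EFin \o f).
    by apply: integrableS iy => //; apply: subset_itvr; rewrite bnd_simp.
  have -> : k * (y - s) = \int[mu]_(x in `]s, y]) k.
    rewrite Rintegral_cst//= lebesgue_measure_itv/= lte_fin.
    have [sy'|ys] := ltP s y; first by rewrite -EFinB.
    by have -> : y = s by [lra]; rewrite subrr.
  apply: le_Rintegral => //.
    apply: (@integrableS _ _ _ mu `[s, y]%classic) => //.
      by apply: subset_itvr; rewrite bnd_simp.
    by apply: (@continuous_itv_integrable (cst k)) => z _;
        exact: cst_continuous.
  by move=> z /=; rewrite in_itv/= => /andP[sz zy]; apply: kf; rewrite zy ltW.
(* Half of the slack [d] goes to the step hypothesis and half to the oscillation of [f] near [s];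
   the summand 1 covers [a = b]. *)
pose d := e / (b - a + 1).
have ba1 : 0 < b - a + 1 by lra.
have d0 : 0 < d by rewrite divr_gt0.
have d20 : 0 < d / 2 by rewrite divr_gt0.
have f_near s : a <= s <= b -> exists2 r, 0 < r &
    forall z, `|z - s| < r -> f s - d / 2 <= f z.
  move=> sab; have /cvgrPdist_le/(_ _ d20)/nbhs_ballP[r r0 Hr] := cf s sab.
  exists r => // z zs; have /Hr : ball s r z by rewrite /ball/= distrC.
  by move=> /=; rewrite ler_norml; lra.
suff : Q b (L + F b + d * (b - a)).
  apply: Qmono; rewrite lerD2l /d mulrAC ler_pdivrMr// ler_pM2l//; lra.
apply: (@real_induction R a b (fun s => Q s (L + F s + d * (s - a))) ab) => //;
    last by rewrite ab lexx.
- rewrite /F set_itv1 Rintegral_set1 subrr mulr0 !addr0//.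
- move=> x /andP[ax xb] /(_ x); rewrite ax lexx => /(_ isT) Qx.
  have xab : a <= x <= b by rewrite ax ltW.
  have [r r0 Hr] := f_near x xab.
  near=> y => xy.
  have yr : `|y - x| < r by near: y; exact: near_dist_lt.
  have yb : `|y - x| < b - x by near: y; apply: near_dist_lt; rewrite subr_gt0.
  have [+ _] : (Q x (L + F x + d * (x - a)) ->
      Q y (L + F x + d * (x - a) + (f x + d / 2) * `|y - x|)) /\
    (Q y (L + F x + d * (x - a)) ->
      Q x (L + F x + d * (x - a) + (f x + d / 2) * `|y - x|)).
    by move: (L + F x + d * (x - a)); near: y; exact: Qstep.
  move=> /(_ Qx); apply: Qmono.
  have yx0 : 0 < y - x by rewrite subr_gt0.
  rewrite gtr0_norm// in yr yb *.
  have := @F_ge x y (f x - d / 2) ax (ltW xy) _.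
  have -> : y <= b by lra.
  move=> /(_ isT) H.
  have {H} : (f x - d / 2) * (y - x) <= F y - F x.
    by apply: H => z /andP[xz zy]; apply: Hr; rewrite ger0_norm; lra.
  lra.
- move=> x /andP[ax xb] IH.
  have xab : a <= x <= b by rewrite xb ltW.
  have [r r0 Hr] := f_near x xab.
  have [y [ya yx yr]] : exists y, [/\ a <= y, y < x & `|y - x| < r /\
      forall L, (Q x L -> Q y (L + (f x + d / 2) * `|y - x|)) /\
    (Q y L -> Q x (L + (f x + d / 2) * `|y - x|))].
    near x^'- => y; exists y; split.
    - by near: y; exact: nbhs_left_ge.
    - by near: y; exact: nbhs_left_lt.
    - near: y; rewrite near_withinE.
      have H1 := near_dist_lt x r0.
      have H2 := Qstep x _ xab d20.
      by apply: filterS2 H1 H2 => y.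
  have [{}yr Qyx] := yr.
  have Qy : Q y (L + F y + d * (y - a)) by apply: IH; rewrite ya.
  have := (Qyx _).2 Qy; apply: Qmono.
  have yx0 : y - x < 0 by rewrite subr_lt0.
  rewrite ltr0_norm// in yr *.
  have : (f x - d / 2) * (x - y) <= F x - F y.
    apply: F_ge => //; first exact: ltW.
    by move=> z /andP[yz zx]; apply: Hr; rewrite ler0_norm; lra.
  lra.
Unshelve. all: by end_near. Qed.

End interval_integral.

Lemma measurable_itv_cat (R : realType) (f : R -> R) (a b c : R) : a <= b <= c
    ->
  measurable_fun `[a, b] f -> measurable_fun `[b, c] f ->
  measurable_fun `[a, c] f.
Proof.
move=> /andP[ab bc] m1 m2.
rewrite (_ : `[a, c]%classic = `[a, b]%classic `|` `[b, c]%classic).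
  by apply/measurable_funU => //.
apply/seteqP; split=> x /=; rewrite !in_itv/=.
  move=> /andP[ax xc]; have [xb|/ltW bx] := leP x b; [left|right].
    by rewrite ax.
  by rewrite bx.
move=> [/andP[ax xb]|/andP[bx xc]]; apply/andP; split=> //; lra.
Qed.

Lemma continuous_scalel (R : realType) (h : R -> R) (s a : R) :
  {for s, continuous h} -> {for s, continuous (fun x => a * h x)}.
Proof. by move=> ch; apply: cvgM => //; exact: cvg_cst. Qed.

Lemma near_eq_speed (R : realType) (n : nat) (M : manifold R n)
    (g : riem_metric M) (sigma tau : R -> M) (t : R) :
  (\forall s \near t, sigma s = tau s) -> speed g sigma t = speed g tau t.
Proof.
move=> E; rewrite /speed (nbhs_singleton E).
set c := chart_at (tau t).
suff -> : 'D_1 (cmap c \o sigma) t = 'D_1 (cmap c \o tau) t by [].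
by apply: near_eq_derive; apply: filterS E => s Es; rewrite /= Es.
Qed.

Section arcs.
Variables (R : realType) (n : nat) (M : manifold R n).
Implicit Types (gamma : R -> M) (a b : R) (s : seq R).

(** Recursive form of [piecewise_smooth], suited to induction on the break points and to appending
    an arc. *)
Fixpoint arcs gamma a s : Prop :=
  if s is v :: s' then [/\ a < v, smooth_arc a v gamma & arcs gamma v s']
  else True.

Lemma piecewise_smoothP a b gamma :
  piecewise_smooth a b gamma <-> exists2 s, arcs gamma a s & last a s = b.
Proof.
split=> [[s [ps /eqP lb] H]|[s H lb]]; exists s => //.
- elim: s a ps lb H => //= v s IH a /andP[av ps] lb H; split=> //.
    exact: (H 0%N).
  by apply: IH => // i; exact: (H i.+1).
- split; last exact/eqP.
  by elim: s a {lb} H => //= v s IH a [-> _ /IH].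
- elim: s a lb H => //= v s IH a lb [av Av /(IH _ lb) H] [|i] //=; exact: H.
Qed.

Lemma arcs_le gamma a s : arcs gamma a s -> a <= last a s.
Proof.
by elim: s a => //= v s IH a [av _ /IH]; apply: le_trans; exact: ltW.
Qed.

Lemma arcs_rcons gamma a s v : arcs gamma a s -> last a s < v ->
  smooth_arc (last a s) v gamma -> arcs gamma a (rcons s v).
Proof.
by elim: s a => //= u s IH a [au Au Hs] uv Auv; split=> //; exact: IH.
Qed.

Lemma eq_arcs gamma gamma' a s :
  (forall t, t <= last a s -> gamma t = gamma' t) ->
  arcs gamma a s -> arcs gamma' a s.
Proof.
elim: s a => //= v s IH a E [av [e [delta [e0 sd Ed]]] Hs]; split=> //.
  exists e, delta; split=> // t atv; rewrite -E ?Ed//.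
  by case/andP: atv => _ /le_trans; apply; exact: arcs_le Hs.
exact: IH.
Qed.

End arcs.

Section curve_creep.
Variables (R : realType) (k n : nat) (N : manifold R k) (M : manifold R n).
Variables (g : riem_metric M) (f : N -> M) (Q : M -> R -> Prop) (kappa : R).
Hypothesis sf : smooth_map f.
Hypothesis kappa0 : 0 <= kappa.
Hypothesis Qmono : forall m L L', L <= L' -> Q m L -> Q m L'.
Hypothesis Qstep : forall sigma s A e, (\forall y \near s, range f (sigma y)) ->
  0 <= A -> displacement g sigma s A -> 0 < e ->
  \forall y \near s, forall L,
    (Q (sigma s) L -> Q (sigma y) (L + kappa * (A + e) * `|y - s|)) /\
    (Q (sigma y) L -> Q (sigma s) (L + kappa * (A + e) * `|y - s|)).
Implicit Types (gamma : R -> N).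

Lemma speed_ge0 (sigma : R -> M) t : 0 <= speed g sigma t.
Proof. exact: gnorm_ge0. Qed.

Lemma smooth_arc_creep gamma u v L : u < v -> smooth_arc u v gamma ->
  Q (f (gamma u)) L ->
  measurable_fun `[u, v] (speed g (f \o gamma)) /\
  exists l, curve_length g u v (f \o gamma) = l%:E /\
    forall e, 0 < e -> Q (f (gamma v)) (L + kappa * l + e).
Proof.
move=> uv [e0 [delta [e00 sd Ed]]] Qu.
have C1d t : u <= t <= v -> C1_at (f \o delta) t.
  move=> /andP[ut tv]; apply: (smooth_map_C1_at sf _ sd);
      first exact: interval_open.
  by rewrite /= in_itv/=; apply/andP; split; lra.
have [h hE] : exists h, h = speed g (f \o delta) by eexists.
have ch t : u <= t <= v -> {for t, continuous h}.
  by rewrite hE => /C1d; exact: C1_speed_continuous.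
have ih := continuous_itv_integrable ch.
have mh : measurable_fun `[u, v] h.
  by apply/measurable_EFinP; exact: (measurable_int (@lebesgue_measure R)).
(* Only interior points are compared: at [u] and [v] the two-sided derivative also sees [gamma]
   outside the arc. *)
have gh : {in `]u, v[, speed g (f \o gamma) =1 h}.
  move=> t; rewrite in_itv/= => /andP[ut tv].
  rewrite hE; apply: near_eq_speed.
  have : \forall s \near t, u < s < v.
    have : nbhs t `]u, v[%classic.
      apply: open_nbhs_nbhs; split; first exact: interval_open.
      by rewrite /= in_itv/= ut.
    by apply: filterS => s /=; rewrite in_itv.
  by apply: filterS => s /andP[us sv] /=; rewrite Ed// !ltW.
have mh' : measurable_fun `]u, v[ h.
  by apply: measurable_funS mh => //; exact: subset_itv_oo_cc.
have [mg Eg] := integral_itv_eq gh mh'.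
have fin : (\int[@lebesgue_measure R]_(x in `[u, v]) (h x)%:E)%E \is a fin_num.
  exact: integrable_fin_num ih.
split; first exact: mg.
exists (\int[@lebesgue_measure R]_(x in `[u, v]) h x).
have lE : curve_length g u v (f \o gamma) =
    (\int[@lebesgue_measure R]_(x in `[u, v]) h x)%:E.
  exact: (etrans Eg (esym (fineK fin))).
split; first exact: lE.
move=> e e1.
have Eu : gamma u = delta u by apply: Ed; rewrite lexx ltW.
have Ev : gamma v = delta v by apply: Ed; rewrite lexx ltW.
rewrite Eu in Qu; rewrite Ev.
have <- : \int[@lebesgue_measure R]_(x in `[u, v]) (kappa * h x) =
    kappa * \int[@lebesgue_measure R]_(x in `[u, v]) h x.
  by apply: RintegralZl ih; exact: measurable_itv.
apply: (@creep R (fun s => Q (f (delta s))) (fun s => kappa * h s) u v L (ltW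
    uv)
  _ _ _ Qu e e1).
- move=> s us; exact: (continuous_scalel (ch s us)).
- move=> s L1 L2; exact: Qmono.
- move=> s e2 usv e20.
  have k1 : 0 < kappa + 1 by rewrite ltr_wpDl.
  have rg : \forall y \near s, range f ((f \o delta) y).
    by near=> y; exists (delta y).
  (* The error [e2 / (kappa + 1)] becomes at most [e2] after multiplication by [kappa], also when
     [kappa = 0]. *)
  have := Qstep rg (speed_ge0 _ _) (C1_displacement g (C1d s usv)) (divr_gt0 e20
      k1).
  apply: filterS => y Hy L1; have [H1 H2] := Hy L1.
  have le : L1 + kappa * (speed g (f \o delta) s + e2 / (kappa + 1)) * `|y - s|
      <= L1 + (kappa * h s + e2) * `|y - s|.
    rewrite -hE lerD2l ler_wpM2r// mulrDr lerD2l mulrCA ger_pMr//.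
    by rewrite ler_pdivrMr// mul1r lerDl.
  by split=> [/H1|/H2]; exact: Qmono.
Unshelve. all: by end_near. Qed.

Lemma arcs_creep gamma a s L : arcs gamma a s -> Q (f (gamma a)) L ->
  measurable_fun `[a, last a s] (speed g (f \o gamma)) /\
  exists l, curve_length g a (last a s) (f \o gamma) = l%:E /\
    forall e, 0 < e -> Q (f (gamma (last a s))) (L + kappa * l + e).
Proof.
elim: s a L => [|v s IH] a L /=.
  move=> _ Qa; rewrite /curve_length set_itv1; split;
      first exact: measurable_fun_set1.
  exists 0; split; first by rewrite integral_set1.
  by move=> e e0; apply: Qmono Qa; rewrite mulr0 addr0 lerDl ltW.
move=> [av Av Hs] Qa.
have [m1 [l1 [E1 H1]]] := smooth_arc_creep av Av Qa.
have [m2 [l2 [E2 _]]] := IH v _ Hs (H1 _ ltr01).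
have le : v <= last v s by exact: arcs_le Hs.
have mm : measurable_fun `[a, last v s] (speed g (f \o gamma)).
  by apply: (measurable_itv_cat _ m1 m2); rewrite (ltW av).
split; first exact: mm.
exists (l1 + l2); split.
  have avl : a <= v <= last v s by rewrite (ltW av).
  rewrite /curve_length (integral_itv_add avl (speed_ge0 _) mm).
  by rewrite EFinD -E1 -E2.
move=> e e0; have e2 : 0 < e / 2 by rewrite divr_gt0.
(* The length must be fixed before [e] is given, so the first use of the induction hypothesis took
   error 1; the second supplies the error [e / 2], and both lengths are the same integral. *)
have [_ [l2' [E2' H2]]] := IH v _ Hs (H1 _ e2).
have -> : l2 = l2' by apply/EFin_inj; rewrite -E2 -E2'.
apply: Qmono (H2 _ e2); lra.
Qed.

Lemma curve_creep gamma a b L : piecewise_smooth a b gamma ->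
  Q (f (gamma a)) L ->
  measurable_fun `[a, b] (speed g (f \o gamma)) /\
  exists l, curve_length g a b (f \o gamma) = l%:E /\
    forall e, 0 < e -> Q (f (gamma b)) (L + kappa * l + e).
Proof. by move=> /piecewise_smoothP[s Hs <-]; exact: arcs_creep. Qed.

End curve_creep.

(** * Points reached by piecewise smooth curves *)

Lemma integral_unit_itv_le (R : realType) (f : R -> R) (b l : R) :
  (forall x, 0 <= f x) -> measurable_fun `[b, b + 1] f ->
  (forall x, b <= x <= b + 1 -> f x <= l) ->
  (\int[@lebesgue_measure R]_(x in `[b, (b + 1)%R]) (f x)%:E <= l%:E)%E.
Proof.
move=> f0 mf fl.
have le : (\int[@lebesgue_measure R]_(x in `[b, (b + 1)%R]) (f x)%:E <=
    \int[@lebesgue_measure R]_(x in `[b, (b + 1)%R]) l%:E)%E.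
  apply: ge0_le_integral => //=.
  - by move=> x _; rewrite lee_fin.
  - exact/measurable_EFinP.
apply: (le_trans le).
rewrite integral_cst//= lebesgue_measure_itv/= lte_fin ltrDl ltr01.
by rewrite -EFinB addrAC subrr add0r mule1.
Qed.

Lemma continuous_line (R : realType) (V : normedModType R) (x w : V) :
  continuous (fun s : R => x + s *: w).
Proof.
move=> s; apply: cvgD; first exact: cvg_cst.
by apply: cvgZr_tmp; exact: cvg_id.
Qed.

Lemma Ck_on_line (R : realType) (V W : normedModType R) k (U : set V)
    (f : V -> W) (x w : V) (J : set R) :
  (forall s, J s -> U (x + s *: w)) -> Ck_on k U f ->
  Ck_on k J (fun s : R => f (x + s *: w)).
Proof.
move=> JU; elim: k f => [f [cf _]|k IH f [cf H]] /=.
  split=> // s Js; apply: (@continuous_comp _ _ _ (fun s : R => x + s *: w) f).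
    exact: continuous_line.
  by apply: cf; exact: JU.
split=> [s Js|v].
  apply: (@continuous_comp _ _ _ (fun s : R => x + s *: w) f).
    exact: continuous_line.
  by apply: cf; exact: JU.
have [df Hf] := H (v *: w); split.
  by move=> s Js; apply/derivable_line; apply: df; exact: JU.
have -> : (fun s : R => 'D_v (fun s : R => f (x + s *: w)) s) =
   (fun s : R => 'D_(v *: w) f (x + s *: w)).
  by apply/funext => s; rewrite derive_line.
exact: IH Hf.
Qed.

Section reach.
Variables (R : realType) (n : nat) (M : manifold R n) (g : riem_metric M).
Implicit Types (p q m : M).

(** A bound on the distance with an explicit witness. Measurability of the speed is carried along
    because the length of a concatenation is split by additivity of the integral. *)
Definition reach p q (L : R) := exists (a b : R) (gamma : R -> M),
  [/\ a <= b, piecewise_smooth a b gamma, gamma a = p /\ gamma b = q,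
      measurable_fun `[a, b] (speed g gamma) &
      (curve_length g a b gamma <= L%:E)%E].

Lemma reach_refl p : reach p p 0.
Proof.
exists 0, 0, (cst p); split=> //; first by exists [::].
- by rewrite set_itv1; exact: measurable_fun_set1.
- by rewrite /curve_length set_itv1 integral_set1.
Qed.

Lemma reach_le p q L L' : L <= L' -> reach p q L -> reach p q L'.
Proof.
move=> LL [a [b [gamma [ab ps e m H]]]]; exists a, b, gamma; split=> //.
by rewrite (le_trans H)// lee_fin.
Qed.

Lemma reach_dist p q L : reach p q L -> (riem_dist g p q <= L%:E)%E.
Proof.
move=> [a [b [gamma [ab ps [ga gb] m]]]]; apply: le_trans.
by apply: ereal_inf_lbound; exists a, b, gamma.
Qed.

Section segment.
Variables (c : chart R M n) (x0 : 'rV[R]_n) (r : R) (m m' : M) (b : R).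
Hypotheses (ac : atlas c) (r0 : 0 < r) (rU : ball x0 r `<=` cimg c).
Hypotheses (cm : cdom c m) (cm' : cdom c m').
Hypotheses (xm : ball x0 (r / 8) (cmap c m)) (xm' : ball x0 (r / 8) (cmap c
    m')).
Let w := cmap c m' - cmap c m.
(** The segment runs over [[b, b + 1]], so that it can be glued without reparametrization to a curve
    ending at time [b]. The interval [J] exceeds it by 1 on each side, as [smooth_arc] asks for a
    larger open interval. *)
Let line s := cmap c m - b *: w + s *: w.
Let seg (s : R) := cinv c (line s).
Let J : set R := `]b - 1, b + 1 + 1[%classic.

Let lineb : line b = cmap c m. Proof. by rewrite /line subrK. Qed.

Let lineb1 : line (b + 1) = cmap c m'.
Proof. by rewrite /line scalerDl scale1r addrA subrK addrC subrK. Qed.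

(** On [J] the parameter is within 2 of [b] and [|w| < r / 4], so the distance to [x0] is less than
    [r / 8 + 2 * (r / 4) < r]. *)
Let line_ball s : J s -> ball x0 r (line s).
Proof.
rewrite /J/= in_itv/= => /andP[s1 s2].
have -> : line s = cmap c m + (s - b) *: w.
  by rewrite /line scalerBl addrAC addrA.
move: xm xm'; rewrite -!ball_normE /ball_/= => h1 h2.
have hw : `|w| <= `|x0 - cmap c m| + `|x0 - cmap c m'|.
  rewrite /w -(subrKA x0) (le_trans (ler_normD _ _))//.
  by rewrite addrC distrC [in leRHS]addrC (distrC x0 (cmap c m')) addrC lexx.
rewrite opprD addrA (le_lt_trans (ler_normB _ _))// normrZ.
have hs : `|s - b| <= 2 by rewrite ler_norml; lra.
have : `|s - b| * `|w| <= 2 * `|w| by rewrite ler_wpM2r.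
have rp := r0; move=> hs2; lra.
Qed.

Let line_cimg s : J s -> cimg c (line s).
Proof. by move=> /line_ball/rU. Qed.

Let cseg s : J s -> cdom c (seg s) /\ cmap c (seg s) = line s.
Proof. by move=> /line_cimg[p cp ps]; rewrite /seg -ps cmapK. Qed.

Let seg_continuous s : J s -> {for s, continuous seg}.
Proof.
move=> Js; apply: (@continuous_comp _ _ _ line (cinv c)).
  exact: continuous_line.
exact/cinv_continuous/line_cimg.
Qed.

Lemma segment_smooth : smooth_curve_on J seg.
Proof.
split=> [s|c' ac' k]; first exact: seg_continuous.
have := transition_smooth ac ac' k; apply: Ck_on_line => s [Js c's].
by have [cs es] := cseg Js; exists (seg s).
Qed.

Lemma segment_speed s : J s -> speed g seg s = gnorm (g c (line s)) w.
Proof.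
move=> Js; have [cs es] := cseg Js.
have nJ : \forall u \near s, J u.
  by apply: open_nbhs_nbhs; split=> //; exact: interval_open.
have dl : is_derive s 1 (cmap c \o seg) w.
  apply: (@near_eq_is_derive _ _ _ line).
    by apply: filterS nJ => u Ju; rewrite /= (cseg Ju).2.
  split; last by rewrite (derive_line id) scale1r derive_id.
  by apply/(derivable_line id); exact: derivable_id.
rewrite (@speed_chart _ _ _ _ c)//; last exact: seg_continuous.
by rewrite es (@derive_val _ _ _ _ _ _ _ dl).
Qed.

Let J_cc s : b <= s <= b + 1 -> J s.
Proof. by move=> /andP[? ?]; rewrite /J/= in_itv/=; apply/andP; split; lra. Qed.

Lemma segment_speed_measurable : measurable_fun `[b, b + 1] (speed g seg).
Proof.
apply/measurable_EFinP; apply: (measurable_int (@lebesgue_measure R)).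
apply: continuous_itv_integrable => s /J_cc Js.
apply: C1_speed_continuous.
apply: (smooth_map_C1_at (@smooth_map_id _ _ M) _ segment_smooth Js).
exact: interval_open.
Qed.

Lemma reach_segment_aux (gamma : R -> M) (a l : R) p (L : R) :
  (forall z, ball x0 r z -> gnorm (g c z) w <= l) ->
  a <= b -> piecewise_smooth a b gamma -> gamma a = p -> gamma b = m ->
  measurable_fun `[a, b] (speed g gamma) ->
  (curve_length g a b gamma <= L%:E)%E -> reach p m' (L + l).
Proof.
move=> hl ab /piecewise_smoothP[s As lb] ga gb mg Lg.
pose tau t := if t <= b then gamma t else seg t.
have b1 : b < b + 1 by rewrite ltrDl.
have segb : seg b = m by rewrite /seg lineb cmapK.
have segb1 : seg (b + 1) = m' by rewrite /seg lineb1 cmapK.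
have tau_seg t : b <= t -> tau t = seg t.
  rewrite le_eqVlt /tau => /orP[/eqP <-|bt]; first by rewrite lexx gb segb.
  by rewrite leNgt bt.
have tau_gamma t : t <= b -> tau t = gamma t by rewrite /tau => ->.
have E1 : {in `]a, b[, speed g tau =1 speed g gamma}.
  move=> t; rewrite in_itv/= => /andP[_ tb]; apply: near_eq_speed.
  have : nbhs t `]-oo, b[%classic.
    by apply: open_nbhs_nbhs; split; [exact: interval_open | rewrite /= in_itv].
  by apply: filterS => u /=; rewrite in_itv/= => ub; exact/tau_gamma/ltW.
have E2 : {in `]b, (b + 1)[, speed g tau =1 speed g seg}.
  move=> t; rewrite in_itv/= => /andP[bt _]; apply: near_eq_speed.
  have : nbhs t `]b, +oo[%classic.
    apply: open_nbhs_nbhs; split; first exact: interval_open.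
    by rewrite /= in_itv/= bt.
  by apply: filterS => u /=; rewrite in_itv/= andbT => bu; exact/tau_seg/ltW.
have mg' : measurable_fun `]a, b[ (speed g gamma).
  by apply: measurable_funS mg => //; exact: subset_itv_oo_cc.
have ms' : measurable_fun `]b, (b + 1)[ (speed g seg).
  by apply: measurable_funS segment_speed_measurable => //;
      exact: subset_itv_oo_cc.
have [m1 I1] := integral_itv_eq E1 mg'.
have [m2 I2] := integral_itv_eq E2 ms'.
have mt : measurable_fun `[a, b + 1] (speed g tau).
  by apply: (measurable_itv_cat _ m1 m2); rewrite ab ltW.
exists a, (b + 1), tau; split.
- exact: le_trans ab (ltW b1).
- apply/piecewise_smoothP; exists (rcons s (b + 1)); last by rewrite last_rcons.
  apply: arcs_rcons; rewrite ?lb.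
  - by apply: eq_arcs As => t; rewrite lb => /tau_gamma.
  - exact: b1.
  - exists 1, seg; split; [exact: ltr01|exact: segment_smooth|].
    by move=> t /andP[bt _]; exact: tau_seg.
- split; first exact: (etrans (tau_gamma a ab) ga).
  exact: (etrans (tau_seg _ (ltW b1)) segb1).
- exact: mt.
- have abb : a <= b <= b + 1 by apply/andP; split; [exact: ab|exact: ltW].
  rewrite /curve_length (integral_itv_add abb (speed_ge0 _ _) mt) I1 I2 EFinD.
  apply: leeD; first exact: Lg.
  apply: integral_unit_itv_le;
      [exact: speed_ge0 | exact: segment_speed_measurable|].
  move=> t /J_cc Jt; rewrite segment_speed; last exact: Jt.
  by apply: hl; exact: line_ball.
Qed.

End segment.

Lemma reach_segment (c : chart R M n) x0 r p m m' l L :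
  atlas c -> 0 < r -> ball x0 r `<=` cimg c -> cdom c m -> cdom c m' ->
  ball x0 (r / 8) (cmap c m) -> ball x0 (r / 8) (cmap c m') ->
  (forall z, ball x0 r z -> gnorm (g c z) (cmap c m' - cmap c m) <= l) ->
  reach p m L -> reach p m' (L + l).
Proof.
move=> ac r0 rU cm cm' xm xm' hl [a [b [gamma [ab ps [ga gb] mg Lg]]]].
exact: (reach_segment_aux ac r0 rU cm cm' xm xm' hl ab ps ga gb mg Lg).
Qed.

(** The points [sigma s] and [sigma y] are joined, in either direction, by a coordinate segment. Its
    chord has length at most [(A + e1) * |y - s|] at [x0], and [1 + th] bounds the variation of the
    metric over the ball; [th] solves [(1 + th) * (A + e1) = A + e]. *)
Lemma displacement_reach sigma s A e p : 0 <= A -> 0 < e ->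
  displacement g sigma s A -> \forall y \near s, forall L,
    (reach p (sigma s) L -> reach p (sigma y) (L + (A + e) * `|y - s|)) /\
    (reach p (sigma y) L -> reach p (sigma s) (L + (A + e) * `|y - s|)).
Proof.
move=> A0 e0 [cont H].
pose c := chart_at (sigma s).
have ac : atlas c by exact: chart_at_atlas.
have cs : cdom c (sigma s) by exact: mem_chart_at.
pose x0 := cmap c (sigma s); have cx0 : cimg c x0 by exact: cimg_cmap.
have pG := metric_posdef_loc g ac cx0.
pose e1 := e / 2; have e10 : 0 < e1 by rewrite divr_gt0.
have Ae1 : 0 < A + e1 by rewrite ltr_wpDl.
pose th := e1 / (A + e1); have th0 : 0 < th by rewrite divr_gt0.
have thE : (1 + th) * (A + e1) = A + e.
  by rewrite mulrDl mul1r /th divfK ?gt_eqF// /e1; field.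
have [d d0 Hd] := gnorm_compare pG th0.
have [r [r0 rU Hr]] : exists r, [/\ 0 < r, ball x0 r `<=` cimg c &
    forall z v, ball x0 r z -> gnorm (g c z) v <= (1 + th) * gnorm (g c x0) v].
  have oc := @open_cimg _ _ _ c.
  have /nbhs_ballP[r r0 Hr] : \forall x \near x0, cimg c x /\ `|g c x - g c x0|
      <= d.
    near=> x; split; first by near: x; apply: open_nbhs_nbhs.
    rewrite distrC; near: x; have [cG _] := metric_smooth g ac 1%N.
    exact: ((cvgrPdist_le _ _).1 (cG _ cx0)).
  exists r; split=> // [x /Hr[]//|z v /Hr[_ zd]].
  by have [] := Hd _ zd v.
have r80 : 0 < r / 8 by rewrite divr_gt0.
near=> y; move=> L.
have cy : cdom c (sigma y) by near: y; exact: near_cdom.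
have xy : ball x0 (r / 8) (cmap c (sigma y)).
  near: y; have cc : {for s, continuous (cmap c \o sigma)}.
    by apply: (continuous_comp cont); exact: cmap_continuous.
  by apply: cc; exact: nbhsx_ballx.
have Hy : gnorm (g c x0) (cmap c (sigma y) - x0) <= (A + e1) * `|y - s|.
  by near: y; exact: (H c ac cs).
have le z : ball x0 r z ->
    gnorm (g c z) (cmap c (sigma y) - x0) <= (A + e) * `|y - s|.
  move=> zr; rewrite (le_trans (Hr _ _ zr))// -thE -mulrA ler_wpM2l//.
  by rewrite addr_ge0// ltW.
split; apply: (reach_segment (c := c) (x0 := x0) (r := r)) => //.
- exact: ballxx.
- exact: ballxx.
- move=> z zr.
  by rewrite -opprB gnormN; exact: le.
Unshelve. all: by end_near. Qed.

End reach.

(** * Estimates for the distance *)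

Section induced_dist_eq0.
Variables (R : realType) (k n : nat) (N : manifold R k) (M : manifold R n).
Variables (g : riem_metric M) (f : N -> M).

(* A curve starting at [f x] has to climb the function [phi], which is
   Lipschitz for the Riemannian distance and vanishes only at [f x]. *)
Lemma induced_dist_eq0 (x y : N) : smooth_map f ->
  induced_dist g f x y = 0%E -> f x = f y.
Proof.
move=> sf d0.
pose c := chart_at (f x).
have ac : atlas c by exact: chart_at_atlas.
have cx : cdom c (f x) by exact: mem_chart_at.
pose x0 := cmap c (f x); have cx0 : cimg c x0 by exact: cimg_cmap.
have pG := metric_posdef_loc g ac cx0.
have [K K0 HK] := gnorm_lower pG.
have [d d00 Hd] := gnorm_compare pG ltr01.
have [r r0 [rU Hr]] : exists2 r, 0 < r & (forall z, `|z - x0| <= r -> cimg c z)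
    /\
    forall z v, `|z - x0| <= r -> `|v| <= 2 * K * gnorm (g c z) v.
  have oc := @open_cimg _ _ _ c.
  have /nbhs_ballP[r /= r0 Hr] : \forall z \near x0, cimg c z /\ `|g c z - g c
      x0| <= d.
    near=> z; split; first by near: z; apply: open_nbhs_nbhs.
    rewrite distrC; near: z; have [cG _] := metric_smooth g ac 1%N.
    exact: ((cvgrPdist_le _ _).1 (cG _ cx0)).
  have rz z : `|z - x0| <= r / 2 -> ball x0 r z.
    rewrite -ball_normE /ball_/= distrC => /le_lt_trans; apply.
    by rewrite ltr_pdivrMr// ltr_pMr// ltr1n.
  exists (r / 2); first by rewrite divr_gt0.
  split=> [z /rz/Hr[]//|z v /rz/Hr[_ zd]].
  have [_ H] := Hd _ zd v; rewrite (le_trans (HK v))//.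
  by rewrite [2 * K]mulrC -mulrA ler_wpM2l// ltW.
have clL := closed_chart_ball r0 rU.
(* The cap [r], also taken as the value off the chart, makes [phi] constant outside a closed
   coordinate ball, so only points of the ball need the Lipschitz estimate. *)
pose phi m := if `[< cdom c m >] then Num.min r `|cmap c m - x0| else r.
have phiE m : cdom c m -> phi m = Num.min r `|cmap c m - x0|.
  by move=> cm; rewrite /phi asboolT.
have phi_out m : ~ (cdom c m /\ `|cmap c m - x0| <= r) -> phi m = r.
  move=> H; rewrite /phi; case: asboolP => // cm.
  by apply: min_l; rewrite leNgt; apply/negP => /ltW ?; apply: H.
have phi_lip m m' : cdom c m -> cdom c m' ->
    phi m' <= phi m + `|cmap c m' - cmap c m|.
  move=> cm cm'; rewrite !phiE// -lerBlDr.
  rewrite le_min; apply/andP; split.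
    by rewrite lerBlDr (le_trans (_ : _ <= r))// ?ge_min ?lexx// lerDl.
  rewrite lerBlDr ge_min; apply/orP; right.
  by rewrite -(subrKA (cmap c m)) addrC (le_trans (ler_normD _ _))// addrC.
have K20 : 0 < 2 * K by rewrite mulr_gt0.
pose Q m (L : R) := phi m <= L.
have Qmono m L L' : L <= L' -> Q m L -> Q m L'.
  by move=> LL /le_trans; apply.
have Qstep sigma s A e : (\forall u \near s, range f (sigma u)) -> 0 <= A ->
    displacement g sigma s A -> 0 < e -> \forall u \near s, forall L,
    (Q (sigma s) L -> Q (sigma u) (L + 2 * K * (A + e) * `|u - s|)) /\
    (Q (sigma u) L -> Q (sigma s) (L + 2 * K * (A + e) * `|u - s|)).
  move=> _ A0 [cont H] e0.
  have [[cs sr]|out] := pselect (cdom c (sigma s) /\ `|cmap c (sigma s) - x0| <=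
      r).
    near=> u; move=> L.
    have cu : cdom c (sigma u) by near: u; exact: near_cdom.
    have Hu : gnorm (g c (cmap c (sigma s))) (cmap c (sigma u) - cmap c (sigma
        s))
        <= (A + e) * `|u - s| by near: u; exact: (H c ac cs).
    have le : `|cmap c (sigma u) - cmap c (sigma s)| <= 2 * K * (A + e) * `|u -
        s|.
      by rewrite (le_trans (Hr _ _ sr))// -[leRHS]mulrA ler_wpM2l// ltW.
    rewrite /Q; split=> HL.
      by rewrite (le_trans (phi_lip _ _ cs cu))// lerD.
    by rewrite (le_trans (phi_lip _ _ cu cs))// lerD// distrC.
  (* Closedness of the coordinate ball in [M] keeps nearby points outside it, where [phi] is [r]. *)
  have nout : \forall u \near s,
      ~ (cdom c (sigma u) /\ `|cmap c (sigma u) - x0| <= r).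
    have : open (~` [set m | cdom c m /\ `|cmap c m - x0| <= r]) by exact:
        closed_openC.
    by move=> oC; apply: (cont _ (open_nbhs_nbhs (conj oC out))).
  near=> u; move=> L.
  have -> : Q (sigma u) = Q (sigma s).
    rewrite /Q (phi_out _ out) phi_out//; first by near: u.
  by split; apply: Qmono; rewrite lerDl !mulr_ge0 ?addr_ge0// ltW.
have phix : phi (f x) = 0.
  by rewrite phiE// subrr normr0 min_r// ltW.
have phiy : phi (f y) <= 0.
  apply/ler_addgt0Pr => e e0; rewrite add0r.
  have e2 : 0 < e / 2 by rewrite divr_gt0.
  have [_ [a [b [gamma [ab ps ga gb ->]]]]] : exists2 z, [set L | exists (a b :
      R) (gamma : R -> N),
    [/\ a <= b, piecewise_smooth a b gamma, gamma a = x, gamma b = y &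
        L = curve_length g a b (f \o gamma)]] z & (z < (e / 2 / (2 * K))%:E)%E.
    apply: ereal_inf_lt; rewrite -/(induced_dist g f x y) d0 lte_fin.
    by rewrite divr_gt0.
  have Qa : Q (f (gamma a)) 0 by rewrite /Q ga phix.
  have [_ [l [-> Hl]]] := curve_creep sf (ltW K20) Qmono Qstep ps Qa.
  rewrite lte_fin ltr_pdivlMr// => lK.
  have := Hl _ e2; rewrite /Q gb add0r => /le_trans; apply.
  by rewrite [leRHS]splitr lerD2r mulrC ltW.
have [cy|ncy] := pselect (cdom c (f y) /\ `|cmap c (f y) - x0| <= r);
    last first.
  by move: phiy; rewrite phi_out// leNgt r0.
move: cy phiy => [cy yr]; rewrite phiE// min_r// normr_le0 subr_eq0 => /eqP H.
by rewrite -(cmapK cx) -(cmapK cy) H.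
Unshelve. all: by end_near. Qed.

End induced_dist_eq0.

Section flow_dist.
Variables (R : realType) (n : nat) (M : manifold R n) (g : riem_metric M).

Lemma riem_dist_ge0 p q : (0 <= riem_dist g p q)%E.
Proof.
apply: le_ereal_inf_tmp => _ [a [b [gamma [_ _ _ _ ->]]]].
by apply: integral_ge0 => t _; rewrite lee_fin speed_ge0.
Qed.

Lemma riem_distxx p : riem_dist g p p = 0%E.
Proof.
apply/eqP; rewrite eq_le riem_dist_ge0 andbT.
exact: (reach_dist (reach_refl g p)).
Qed.

Lemma nabla_norm_ge0 (X : vector_field M) p : (0 <= nabla_norm g X p)%E.
Proof.
set c := chart_at p.
apply: (@le_trans _ _ (gnorm (g c (cmap c p)) (cov_deriv g X c (cmap c p)
    0))%:E).
  by rewrite lee_fin gnorm_ge0.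
apply: ereal_sup_ubound; exists 0 => //=.
by rewrite gnorm0.
Qed.

Variables (X : vector_field M) (D : M -> set R) (Fl : R -> M -> M).
Variables (k : nat) (N : manifold R k) (f : N -> M) (T C t : R).
Hypothesis flX : is_flow X D Fl.
Hypothesis sf : smooth_map f.
Hypothesis AD : forall p s, range f p -> 0 <= s <= T -> D p s.
Hypothesis C0 : 0 <= C.
Hypothesis hC : forall q, flow_image Fl T (range f) q ->
  (nabla_norm g X q <= C%:E)%E.
Hypothesis tT : 0 <= t <= T.

(** Creeping along a curve in [N] of length less than [r + e], with expansion factor [E]. The inner
    [e] is the excess of that length, the outer one the error of the creeping, and the one in the
    exponent the error in the growth rate. *)
Lemma flow_dist_le (x y : N) (r e : R) : induced_dist g f x y = r%:E -> 0 < e ->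
  (riem_dist g (Fl t (f x)) (Fl t (f y)) <=
   (expR ((C + e) * t) * (r + e) + e)%:E)%E.
Proof.
move=> dr e0; set E := expR _; have E0 : 0 < E by exact: expR_gt0.
pose Q m (L : R) := reach g (Fl t (f x)) (Fl t m) L.
have Qmono m L L' : L <= L' -> Q m L -> Q m L' by exact: reach_le.
have Qstep sigma s A e1 : (\forall u \near s, range f (sigma u)) -> 0 <= A ->
    displacement g sigma s A -> 0 < e1 -> \forall u \near s, forall L,
    (Q (sigma s) L -> Q (sigma u) (L + E * (A + e1) * `|u - s|)) /\
    (Q (sigma u) L -> Q (sigma s) (L + E * (A + e1) * `|u - s|)).
  move=> nA A0 H e10.
  have H1 := flow_displacement flX AD C0 hC nA tT e0 A0 H.
  rewrite mulrDr [E * A]mulrC.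
  by apply: displacement_reach H1; [rewrite mulr_ge0 // ltW | rewrite mulr_gt0].
have [_ [a [b [gamma [ab ps ga gb ->]]]]] : exists2 z, [set L | exists (a b : R)
    (gamma : R -> N),
    [/\ a <= b, piecewise_smooth a b gamma, gamma a = x, gamma b = y &
        L = curve_length g a b (f \o gamma)]] z & (z < (r + e)%:E)%E.
  apply: ereal_inf_lt; rewrite -/(induced_dist g f x y) dr lte_fin.
  by rewrite ltrDl.
have Qa : Q (f (gamma a)) 0 by rewrite /Q ga; exact: reach_refl.
have [_ [l [-> Hl]]] := curve_creep sf (ltW E0) Qmono Qstep ps Qa.
rewrite lte_fin => lr.
have := Hl _ e0; rewrite /Q gb add0r => H; apply: reach_dist.
by apply: reach_le H; rewrite lerD2r ler_pM2l// ltW.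
Qed.

Lemma flow_dist (x y : N) (r : R) : induced_dist g f x y = r%:E ->
  (riem_dist g (Fl t (f x)) (Fl t (f y)) <= (r * expR (C * t))%:E)%E.
Proof.
move=> dr; apply/lee_addgt0Pr => e e0; rewrite -EFinD.
pose h (u : R) : R := expR ((C + u) * t) * (r + u) + u.
have ch : h u @[u --> (0 : R)] --> h 0.
  have cid : (u : R) @[u --> (0 : R)] --> (0 : R) by exact: cvg_id.
  apply: cvgD => //; apply: cvgM; last by apply: cvgD => //; exact: cvg_cst.
  apply: (@continuous_comp _ _ _ (fun u : R => (C + u) * t) expR);
      last exact: continuous_expR.
  by apply: cvgM; [apply: cvgD => //; exact: cvg_cst | exact: cvg_cst].
have h0 : h 0 < r * expR (C * t) + e by rewrite /h !addr0 mulrC ltrDl.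
near (0 : R)^'+ => u.
have u0 : 0 < u by near: u; exact: nbhs_right_gt.
rewrite (le_trans (flow_dist_le dr u0))// lee_fin -/(h u) ltW//.
near: u; apply: cvg_within; exact: (cvgr_lt _ ch).
Unshelve. all: by end_near. Qed.

End flow_dist.

Theorem theorem4 (R : realType) (n : nat) (M : manifold R n)
    (g : riem_metric M) (X : vector_field M)
    (D : M -> set R) (Fl : R -> M -> M)
    (p0 q0 : M)
    (k : nat) (N : manifold R k) (iota : N -> M) (x0 y0 : N) (T : R) :
  connected [set: M] ->
  is_flow X D Fl ->
  submanifold iota ->
  relatively_compact (range iota) ->
  iota x0 = p0 ->
  iota y0 = q0 ->
  riem_dist g p0 q0 = induced_dist g iota x0 y0 ->
  0 < T ->
  (forall p t, range iota p -> 0 <= t <= T -> D p t) ->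
  let C_T := sup_nabla_norm g X (flow_image Fl T (range iota)) in
  forall t : R, 0 <= t <= T ->
  (riem_dist g (Fl t p0) (Fl t q0) <=
   riem_dist g p0 q0 * expeR (C_T * t%:E))%E.
Proof.
move=> _ flX [_ sf _] _ <- <- dE T0 AD C_T t tT.
have C_T0 : (0 <= C_T)%E.
  apply: le_trans (nabla_norm_ge0 g X (iota x0)) _; apply: ereal_sup_ubound.
  exists (iota x0) => //; exists 0, (iota x0); split; first by rewrite lexx ltW.
    by exists x0.
  by rewrite (flow0 flX).
have t0 : 0 <= t by case/andP: tT.
(* At [t = 0] the exponent is 0 even if [C_T = +oo], since [+oo * 0 = 0], so this case is not
   void. *)
have [t00|tn0] := eqVneq t 0.
  by rewrite t00 mule0 expeR0 mule1 !(flow0 flX).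
have tp : 0 < t by rewrite lt_neqAle eq_sym tn0.
have d0 := riem_dist_ge0 g (iota x0) (iota y0).
(* The right-hand side is 0 here whatever [C_T] is, since [0 * +oo = 0], and the two flowed points
   must be shown to coincide. *)
have [dz|dn0] := eqVneq (riem_dist g (iota x0) (iota y0)) 0%E.
  have <- : iota x0 = iota y0 by apply: (@induced_dist_eq0 _ _ _ _ _ g) => //;
      rewrite -dE.
  by rewrite riem_distxx riem_distxx mul0e.
have dp : (0 < riem_dist g (iota x0) (iota y0))%E by rewrite lt_def dn0.
case E : C_T C_T0 => [C||] // C0; last first.
  by rewrite gt0_mulye ?lte_fin//= gt0_muley ?leey.
have hC q : flow_image Fl T (range iota) q -> (nabla_norm g X q <= C%:E)%E.
  by move=> Aq; rewrite -E; apply: ereal_sup_ubound; exists q.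
case dr : (riem_dist g (iota x0) (iota y0)) => [r||].
- apply: (flow_dist flX sf AD C0 hC tT); by rewrite -dE.
- by rewrite gt0_mulye ?leey//= lte_fin expR_gt0.
- by rewrite dr in d0.
Qed.
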